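(* Let $G$ and $H$ be graphs that are not matchings such that $H$ is strictly balanced with respect to $d_2(G,\cdot)$. Then there exists a constant $C>0$ such that for $p=p(n)\geq C n^{-1/m_2(G,H)}$ we have $$\lim_{n\to\infty}\Pr\big(G_{n,p}\rightarrow (G,H)\big)=1.$$
   Context: For a graph $F$, $e_F$ and $v_F$ denote its numbers of edges and vertices; a graph is nonempty if it has at least one edge, and a matching if it has maximum degree at most $1$. For a graph $H$ define $d_2(H)=(e_H-1)/(v_H-2)$ if $v_H\geq 3$, $d_2(K_2)=1/2$, and $d_2(H)=0$ if $e_H=0$; let $m_2(H)=\max_{J\subseteq H} d_2(J)$ (maximum over all subgraphs). For graphs $G,H$ define $d_2(G,H)=e_H/(v_H-2+1/m_2(G))$ if $e_G,e_H\geq 1$, and $d_2(G,H)=0$ otherwise; let $m_2(G,H)=\max_{J\subseteq H} d_2(G,J)$. $H$ is balanced w.r.t. $d_2(G,\cdot)$ if $m_2(G,H)=d_2(G,H)$, and strictly balanced w.r.t. $d_2(G,\cdot)$ if in addition $m_2(G,H)>d_2(G,J)$ for every proper subgraph $J\subsetneq H$. $G_{n,p}$ is the binomial random graph on vertex set $[n]$ in which each edge is present independently with probability $p$. $F\rightarrow(G,H)$ means that every red-blue coloring of the edges of $F$ contains a red copy of $G$ or a blue copy of $H$. *)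

(* Defs.v *)
From HB Require Import structures.
From mathcomp Require Import all_boot all_order all_algebra.
From mathcomp Require Import all_classical all_reals all_analysis.
Set Implicit Arguments.
Unset Strict Implicit.
Unset Printing Implicit Defensive.
Import Order.TTheory GRing.Theory Num.Theory.
Local Open Scope ring_scope.

(* A finite simple graph is a pair (vertex set, edge set) inside an ambient   *)
(* finite type, edges being 2-element sets of vertices.  The vertex set need  *)
(* not exhaust the ambient type, so that a subgraph of a graph on T is again  *)
(* a graph on T.                                                              *)
Section Graph.
Variable T : finType.

Definition graph_axiom (g : {set T} * {set {set T}}) : bool :=
  [forall e in g.2, (#|e| == 2)%N && (e \subset g.1)].

Record graph := Graph {
  graph_val : {set T} * {set {set T}};
  _ : graph_axiom graph_val }.

HB.instance Definition _ := [isSub for graph_val].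
HB.instance Definition _ := [Finite of graph by <:].

Definition verts (F : graph) : {set T} := (graph_val F).1.
Definition edges (F : graph) : {set {set T}} := (graph_val F).2.

Definition nverts (F : graph) : nat := #|verts F|.
Definition nedges (F : graph) : nat := #|edges F|.

Definition subgraph (J F : graph) : bool :=
  (verts J \subset verts F) && (edges J \subset edges F).

Definition proper_subgraph (J F : graph) : bool := subgraph J F && (J != F).

Definition degree (F : graph) (x : T) : nat := #|[set e in edges F | x \in e]|.

Definition matching (F : graph) : bool :=
  (\max_(x in verts F) degree F x <= 1)%N.

Lemma edge_restrict_axiom (F : graph) (P : pred {set T}) :
  graph_axiom (verts F, [set e in edges F | P e]).
Proof.
apply/forall_inP => e /=; rewrite inE => /andP[eF _].
by case: F eF => g gP /= eg; apply: (forall_inP gP).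
Qed.

Definition edge_restrict (F : graph) (P : pred {set T}) : graph :=
  Graph (edge_restrict_axiom F P).

End Graph.

(* F contains a (not necessarily induced) copy of G. *)
Definition contains (T U : finType) (F : graph T) (G : graph U) : bool :=
  [exists f : {ffun {x : U | x \in verts G} -> T},
    [&& injectiveb f,
        [forall x, f x \in verts F]
      & [forall x, forall y,
          ([set val x; val y] \in edges G) ==> ([set f x; f y] \in edges F)]]].

(* Red is true and blue is false; the values of the colouring c outside of    *)
(* edges F play no role.                                                      *)
Definition arrows (T U V : finType)
    (F : graph T) (G : graph U) (H : graph V) : bool :=
  [forall c : {ffun {set T} -> bool},
    contains (edge_restrict F (fun e => c e)) G
    || contains (edge_restrict F (fun e => ~~ c e)) H].

Section Densities.
Variable T : finType.

(* A graph with at least one edge and at most two vertices is K_2. *)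
Definition d2 (F : graph T) : rat :=
  if nedges F == 0%N then 0
  else if (3 <= nverts F)%N then
    ((nedges F)%:R - 1) / ((nverts F)%:R - 2)
  else 1 / 2.

(* The default value 0 of the maximum is harmless here and in m2_asym, as the *)
(* densities are nonnegative and the graph itself is among its subgraphs.     *)
Definition m2 (F : graph T) : rat :=
  \big[Num.max/0]_(J : graph T | subgraph J F) d2 J.

End Densities.

Section AsymmetricDensities.
Variables (T U : finType) (G : graph T).

Definition d2_asym (H : graph U) : rat :=
  if (1 <= nedges G)%N && (1 <= nedges H)%N then
    (nedges H)%:R / ((nverts H)%:R - 2 + 1 / m2 G)
  else 0.

Definition m2_asym (H : graph U) : rat :=
  \big[Num.max/0]_(J : graph U | subgraph J H) d2_asym J.

Definition balanced (H : graph U) : Prop := m2_asym H = d2_asym H.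

Definition strictly_balanced (H : graph U) : Prop :=
  balanced H /\
  forall J : graph U, proper_subgraph J H -> d2_asym J < m2_asym H.

End AsymmetricDensities.

(* The probability that the binomial random graph G_{n,p}, on vertex set      *)
(* 'I_n, has the property A.                                                  *)
Definition Gnp_prob (R : realType) (n : nat) (p : R)
    (A : pred (graph 'I_n)) : R :=
  \sum_(F : graph 'I_n | (verts F == [set: 'I_n]) && A F)
    \prod_(e : {set 'I_n} | #|e| == 2%N) (if e \in edges F then p else 1 - p).

(* Main.v *)
(* Suppose a colouring has neither a red G nor a blue H, and shrink its set Q
   of red edges until it is minimal: then every red edge e lies in a copy of H
   whose only red edge is e.  By the container theorem Q is contained in
   S \cup f(S) for some S \subseteq Q with |S| = O(s), s = n^(2 - 1/m_2(G)),
   where S \cup f(S) contains few copies of G.  By supersaturation in Ramsey's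
   theorem the complement of S \cup f(S) then contains a positive proportion
   of all copies of H; none of them is in the random graph, which by Janson's
   inequality has probability at most exp(-c C^(e_H) s).

   There are exp(O(s log n)) sets S, so the union bound must use the copies of
   H at the edges of S.  Since H is strictly balanced, pairs of copies that
   share an edge are rare: all but o(s / log n) edges of S are covered by a
   family of at most |S| pairwise edge-disjoint copies in the random graph.
   Summing over these families instead costs only a factor
   exp(O(s) + (c/4) C^(e_H) s), and Janson's inequality wins when C is large. *)

(* The definition of m_2(G,H) makes Q = n^(v_H) p^(e_H) equal to C^(e_H) s when p = C
   n^(-1/m_2(G,H)). Janson's exponent and the number of fingerprint edges thus have the same order
   in n: the union bound cannot afford a factor log n, and only C is left to choose. The logarithm
   comes from the n^2 positions open to each edge of S. But S lies in the minimal red set, so each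
   of its edges e brings a copy of H that meets S in e alone, and different edges bring different
   copies. A disjoint family of k copies is present with probability p^(k e_H), so the families of
   size k have total weight at most Q^k / k!; no logarithm appears, as Q has the order of s. The few
   edges whose copies clash are still listed one by one. Strict balancedness saves a power n^(-del)
   in the expected number of clashing pairs, which beats the log n paid for these edges and also
   makes the correction term in Janson's inequality negligible. *)
Require Import Defs.
From HB Require Import structures.
From mathcomp Require Import all_boot all_order all_algebra.
From mathcomp Require Import reals sequences exp.
From mathcomp Require Import ring lra zify.
Set Implicit Arguments.
Unset Strict Implicit.
Unset Printing Implicit Defensive.
Import Order.TTheory GRing.Theory Num.Theory.
Local Open Scope ring_scope.

(** * Containers *)

Section First.
Variable V : finType.
Implicit Types (s : seq V) (I J : {set V}).

Definition first s I : option V := ohead [seq v <- s | v \in I].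

Lemma first_stable s I J v :
  first s I = Some v -> v \in J -> J \subset I -> first s J = Some v.
Proof.
rewrite /first => + vJ JI; elim: s => //= a s IH.
case: ifP => [aI [->]|aI fsI]; first by rewrite vJ.
case: ifP => [aJ|_]; last exact: IH.
by rewrite (subsetP JI _ aJ) in aI.
Qed.

Lemma first_None s I v : first s I = None -> v \in s -> v \notin I.
Proof.
rewrite /first; elim: s => //= a s IH.
case: ifPn => [//|aI fsI]; rewrite inE => /orP[/eqP->//|]; exact: IH.
Qed.

Lemma first_NoneW s I J : first s I = None -> J \subset I -> first s J = None.
Proof.
move=> fsI JI; case fsJ: (first s J) => [v|//].
have : v \in [seq v <- s | v \in J].
  by move: fsJ; rewrite /first; case: filter => //= a l [->]; rewrite inE eqxx.
rewrite mem_filter => /andP[vJ vs].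
by move: (first_None fsI vs); rewrite (subsetP JI _ vJ).
Qed.

Lemma first_in s I v : first s I = Some v -> v \in I.
Proof.
rewrite /first; elim: s => //= a s IH.
by case: ifPn => [aI [<-]|_].
Qed.

Lemma first_min (r : rel V) s I v u : transitive r -> reflexive r ->
  sorted r s -> first s I = Some v -> u \in s -> u \in I -> r v u.
Proof.
move=> tr rr; rewrite /first; elim: s => //= a s IH pas.
case: ifPn => aI.
  by case=> <-; rewrite inE => /orP[/eqP-> _|us _]; [apply: rr|apply: (allP (order_path_min tr pas))].
move=> fsI; rewrite inE => /orP[/eqP->|us uI]; first by rewrite (negbTE aI).
by apply: IH => //; apply: path_sorted pas.
Qed.

End First.

Section Containers.
Variables (R : realFieldType) (V : finType).
Implicit Types (w g : {set V} -> R) (S I J W E T : {set V}).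
Implicit Types (x : {set V} * ({set V} -> R)).

Lemma disjointsU1 v E S : [disjoint E & v |: S] = (v \notin E) && [disjoint E & S].
Proof.
rewrite !disjoints_subset setCU subsetI; congr (_ && _).
by rewrite -disjoints_subset disjoint_sym disjoints1.
Qed.

Definition wdeg w T : R := \sum_(E : {set V} | T \subset E) w E.

Lemma wdeg0E w : wdeg w set0 = \sum_E w E.
Proof. by apply: eq_bigl => E; rewrite sub0set. Qed.

Lemma wdegS w g T : (forall E, w E <= g E) -> wdeg w T <= wdeg g T.
Proof. by move=> wg; apply: ler_sum. Qed.

Lemma wdeg_ge0 w T : (forall E, 0 <= w E) -> 0 <= wdeg w T.
Proof. by move=> w0; apply: sumr_ge0. Qed.

(** The value 0 at sets containing v prevents an edge of w from being counted twice, as E and as E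
    without v. *)
Definition link (v : V) w E : R := if v \in E then 0 else w (v |: E).

Lemma wdeg_link v w T :
  wdeg (link v w) T = if v \in T then 0 else wdeg w (v |: T).
Proof.
case: ifPn => vT.
  by apply: big1 => E TE; rewrite /link (subsetP TE).
rewrite /wdeg (bigID (fun E => v \in E)) /= big1 ?add0r; last first.
  by move=> E /andP[_ vE]; rewrite /link vE.
rewrite [RHS](reindex_onto (fun E => v |: E) (fun E => E :\ v)) /=; last first.
  by move=> E; rewrite subUset sub1set => /andP[vE _]; rewrite setD1K.
apply: eq_big => [E|E /andP[_ vE]]; last by rewrite /link (negbTE vE).
rewrite subUset sub1set setU11 /=.
have [vE|vE] /= := boolP (v \in E).
  rewrite andbF; apply/esym/negbTE; apply: contraL vE => /andP[_ /eqP<-].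
  by rewrite !inE eqxx.
rewrite andbT setU1K // eqxx andbT; apply/idP/idP => [TE|/subsetP TE].
  exact: subset_trans TE (subsetUr _ _).
apply/subsetP => x xT; move: (TE x xT); rewrite !inE => /orP[/eqP xv|//].
by rewrite -xv xT in vT.
Qed.

Lemma sum_wdeg w : \sum_T wdeg w T = \sum_(E : {set V}) 2 ^+ #|E| * w E.
Proof.
rewrite /wdeg (exchange_big_dep xpredT) //=; apply: eq_bigr => E _.
rewrite sumr_const -[LHS]mulr_natl; congr (_ * _).
rewrite -natrX; congr (_%:R); rewrite -card_powerset; apply: eq_card => T.
by rewrite inE.
Qed.

Lemma sum_wdeg1 w W : \sum_(v in W) wdeg w [set v] = \sum_(E : {set V}) #|E :&: W|%:R * w E.
Proof.
rewrite /wdeg (exchange_big_dep xpredT) //=; apply: eq_bigr => E _.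
rewrite sumr_const -[LHS]mulr_natl; congr (_%:R * _).
by apply: eq_card => v; rewrite !inE unfold_in sub1set andbC.
Qed.

Section Run.
Variables (p : R) (w : {set V} -> R) (D : R).
Hypotheses (p_gt0 : 0 < p) (p_le1 : p <= 1) (D_gt0 : 0 < D).
Hypothesis w_ge0 : forall E, 0 <= w E.

(* One round of the Nenadov--Pham container algorithm.  Its state consists of
   the vertices picked so far and the total weight g of their links.  An edge
   containing a set saturated in g is discarded, so that the degrees of g stay
   bounded; discarding loses little weight unless g is heavy. *)
Definition unsat g E :=
  [forall T : {set V}, (T != set0) && (T \subset E) ==> (wdeg g T < D * p ^+ #|T|)].

Definition avail (x : {set V} * ({set V} -> R)) E : R :=
  if [disjoint E & x.1] && unsat x.2 E then w E else 0.

(** By decreasing available degree, so that a pick has the largest available degree among the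
    vertices of I not yet picked. *)
Definition order x : seq V :=
  sort (fun u v => wdeg (avail x) [set v] <= wdeg (avail x) [set u]) (enum V).

Definition step I (x : {set V} * ({set V} -> R)) :=
  if first (order x) (I :\: x.1) is Some v
  then (v |: x.1, fun E => x.2 E + link v (avail x) E) else x.

Definition run k I := iter k (step I) (set0, fun=> 0).

Lemma step_incr I x : x.1 \subset (step I x).1.
Proof. by rewrite /step; case: first => //= v; rewrite subsetUr. Qed.

(* Every pick is the first element of I in an order that depends on the state
   only, so it can be recovered from any J containing the picks. *)
Lemma run_stable k I J : (run k I).1 \subset J -> J \subset I -> run k J = run k I.
Proof.
move=> + JI; elim: k => //= k IH sJ.
rewrite IH; last by apply: subset_trans sJ; apply: step_incr.
move: sJ; set x := run k I; rewrite /step.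
case fI: first => [v|].
  rewrite /= subUset sub1set => /andP[vJ _].
  rewrite (first_stable fI) ?setSD //.
  by have := first_in fI; rewrite !inE vJ andbT => /andP[].
by move=> _; rewrite (first_NoneW fI) // setSD.
Qed.

Lemma run_sub k I : (run k I).1 \subset I.
Proof.
elim: k => [|k IH] /=; first exact: sub0set.
rewrite /step; case fI: first => [v|//]; rewrite subUset sub1set IH andbT.
by have := first_in fI; rewrite !inE => /andP[].
Qed.

Lemma run_card k I : (#|(run k I).1| <= k)%N.
Proof.
elim: k => [|k IH] /=; first by rewrite cards0.
rewrite /step; case fI: first => [v|]; last exact: leq_trans IH _.
by rewrite /= cardsU1 -[k.+1]add1n leq_add // leq_b1.
Qed.

Lemma avail_ge0 x E : 0 <= avail x E.
Proof. by rewrite /avail; case: ifP. Qed.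

Lemma avail_le x E : avail x E <= w E.
Proof. by rewrite /avail; case: ifP. Qed.

Lemma link_ge0 x v E : 0 <= link v (avail x) E.
Proof. by rewrite /link; case: ifP => // _; apply: avail_ge0. Qed.

Lemma run_ge0 k I E : 0 <= (run k I).2 E.
Proof.
elim: k => //= k IH; rewrite /step; case fI: first => [v|//] /=.
by apply: addr_ge0 => //; apply: link_ge0.
Qed.

Lemma run_neq0 k I E : (run k I).2 E != 0 ->
  exists2 v, v \in I :\: E & w (v |: E) != 0.
Proof.
elim: k => [|k IH] /=; first by rewrite eqxx.
rewrite /step; case fI: first => [v|//] /=.
have [->|/IH//] := eqVneq ((run k I).2 E) 0.
rewrite add0r /link; case: ifPn => [_|vE]; rewrite ?eqxx // /avail.
case: ifP => [_ wvE|]; rewrite ?eqxx //; exists v => //.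
by have := first_in fI; rewrite !inE vE => /andP[].
Qed.

Lemma wdegD g g' T : wdeg (fun E => g E + g' E) T = wdeg g T + wdeg g' T.
Proof. exact: big_split. Qed.

Lemma wdeg_avail_sat x T T' : T != set0 -> T \subset T' ->
  ~~ (wdeg x.2 T < D * p ^+ #|T|) -> wdeg (avail x) T' = 0.
Proof.
move=> T0 TT' sT; apply: big1 => E TE; rewrite /avail; case: ifP => // /andP[_].
by move=> /forallP/(_ T); rewrite T0 (subset_trans TT' TE) (negbTE sT).
Qed.

(** One step adds at most D p^|T| to the degree of T, by the bound on [wdeg w (v |: T)]. It adds
    nothing once T is saturated, that is, once its degree has reached D p^|T|; so the degree never
    passes twice this value. *)
Lemma run_deg k I T : (forall T, T != set0 -> wdeg w T <= D * p ^+ #|T|.-1) ->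
  T != set0 -> wdeg (run k I).2 T <= 2 * D * p * p ^+ #|T|.-1.
Proof.
move=> wD T0; have pT : p * p ^+ #|T|.-1 = p ^+ #|T|.
  by rewrite -exprS prednK // card_gt0.
rewrite -mulrA pT; elim: k => [|k IH] /=.
  by rewrite /wdeg big1 // !mulr_ge0 ?exprn_ge0 ?ler0n // ltW.
rewrite /step; case fI: first => [v|//] /=.
rewrite wdegD wdeg_link; case: ifPn => vT; first by rewrite addr0.
set x := run k I in IH fI *.
have vT0 : v |: T != set0 by apply/set0Pn; exists v; rewrite !inE eqxx.
have [sT|sT] := boolP (wdeg x.2 T < D * p ^+ #|T|); last first.
  by rewrite (wdeg_avail_sat T0 _ sT) ?addr0 // subsetUr.
have := wD _ vT0; rewrite cardsU1 vT /= => wvT.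
have := wdegS (v |: T) (avail_le x).
by move: sT wvT; lra.
Qed.

Lemma avail_decr x v E :
  avail (v |: x.1, fun E => x.2 E + link v (avail x) E) E <= avail x E.
Proof.
rewrite /avail /=; case: ifP => [/andP[dE uE]|_]; last by case: ifP.
case: ifPn => // /negP[]; apply/andP; split.
  by move: dE; rewrite disjointsU1 => /andP[].
apply/forall_inP => T /andP[T0 TE].
move/forall_inP/(_ T): uE; rewrite T0 TE => /(_ isT); apply: le_lt_trans.
by apply: wdegS => F; rewrite lerDl; apply: link_ge0.
Qed.

(** An unpicked u in I lost to every pick, so each of the k picks had at least the available degree
    that u has at the end, degrees only decreasing. Each pick added its own degree to the total
    weight of g. *)
Lemma run_max k I u : u \in I :\: (run k I).1 ->
  k%:R * wdeg (avail (run k I)) [set u] <= wdeg (run k I).2 set0.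
Proof.
elim: k u => [|k IH] u; first by rewrite mul0r; move=> _; apply: wdeg_ge0.
rewrite /=; set x := run k I in IH *; rewrite /step.
case fI: first => [v|] /=; last first.
  by move=> uI; have := first_None fI; move=> /(_ u); rewrite mem_sort mem_enum uI => /(_ isT).
rewrite !inE negb_or => /andP[/andP[uv ux] uI].
have {}uI : u \in I :\: x.1 by rewrite inE ux.
have uv' : wdeg (avail x) [set u] <= wdeg (avail x) [set v].
  apply: (first_min (r := fun u v => wdeg (avail x) [set v] <= wdeg (avail x) [set u])
    _ _ _ fI) => //.
  - by move=> a b c /= ba ac; apply: le_trans ac ba.
  - by apply: sort_sorted => a b; apply: le_total.
  - by rewrite mem_sort mem_enum.
rewrite wdegD wdeg_link inE setU0 -natr1 mulrDl mul1r.
have le1 := wdegS [set u] (@avail_decr x v).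
rewrite lerD //; last exact: le_trans le1 uv'.
by apply: le_trans (IH _ uI); rewrite ler_wpM2l.
Qed.

(** Since g only grows, an edge unsaturated at the end was so all along; hence it was available when
    a pick first hit it, and its weight went into the link of that pick. *)
Lemma run_meets k I : \sum_(E : {set V} | ~~ [disjoint E & (run k I).1] && unsat (run k I).2 E) w E
  <= wdeg (run k I).2 set0.
Proof.
elim: k => [|k IH] /=.
  by rewrite big_pred0 ?wdeg_ge0 // => E; rewrite disjoints_subset setC0 subsetT.
set x := run k I in IH *; rewrite /step.
case fI: first => [v|//] /=; rewrite wdegD wdeg_link inE setU0.
apply: le_trans (lerD IH (lexx _)).
rewrite /wdeg big_mkcond [X in _ <= X + _]big_mkcond [X in _ <= _ + X]big_mkcond.
rewrite -big_split /=; apply: ler_sum => E _.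
rewrite sub1set /avail disjointsU1.
have [un|_] := boolP (unsat _ E); last first.
  rewrite andbF addr_ge0 //; first by case: ifP.
  by case: ifP => // _; case: ifP.
have -> : unsat x.2 E.
  apply/forall_inP => T /andP[T0 TE].
  move/forall_inP/(_ T): un; rewrite T0 TE => /(_ isT); apply: le_lt_trans.
  by apply: wdegS => F; rewrite lerDl; apply: link_ge0.
rewrite !andbT; case: (v \in E) => /=; case: [disjoint E & x.1] => //=;
  by rewrite ?addr0 ?add0r // w_ge0.
Qed.

(** Charge a discarded edge to a saturated subset T. The degree of T in w is at most D p^(|T|-1),
    hence at most its degree in g divided by p; and every edge of g has only 2^m subsets. *)
Lemma unsat_total g m : (forall E, 0 <= g E) -> (forall E, g E != 0 -> #|E| = m) ->
  (forall T, T != set0 -> wdeg w T <= D * p ^+ #|T|.-1) ->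
  p * (\sum_(E : {set V} | ~~ unsat g E) w E) <= 2 ^+ m * wdeg g set0.
Proof.
move=> g0 gm wD.
pose sat (T : {set V}) := (T != set0) && ~~ (wdeg g T < D * p ^+ #|T|).
have : \sum_(E : {set V} | ~~ unsat g E) w E <= \sum_(T : {set V} | sat T) wdeg w T.
  rewrite /wdeg (exchange_big_dep xpredT) //= [leLHS]big_mkcond.
  apply: ler_sum => E _; case: ifPn => [|_]; last exact: sumr_ge0.
  rewrite negb_forall => /existsP[T]; rewrite negb_imply -andbA.
  move=> /and3P[T0 TE sT]; rewrite (bigD1 T) /= ?lerDl ?sumr_ge0 //.
  by rewrite /sat T0 sT TE.
move=> /(ler_wpM2l (ltW p_gt0)) /le_trans; apply.
have -> : 2 ^+ m * wdeg g set0 = \sum_T wdeg g T.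
  rewrite sum_wdeg wdeg0E mulr_sumr; apply: eq_bigr => E _.
  by have [->|/gm->//] := eqVneq (g E) 0; rewrite !mulr0.
rewrite mulr_sumr [leLHS]big_mkcond; apply: ler_sum => T _.
case: ifPn => [/andP[T0]|_]; last exact: wdeg_ge0.
rewrite -leNgt; apply: le_trans.
have -> : p ^+ #|T| = p * p ^+ #|T|.-1 by rewrite -exprS prednK // card_gt0.
by rewrite mulrCA ler_wpM2l ?wD // ltW.
Qed.

End Run.

Section Cont.
Variables (p N : R) (L : nat).
Hypotheses (p_gt0 : 0 < p) (p_le1 : p <= 1) (N_gt0 : 0 < N).
Hypotheses (pNL : p * N <= L%:R).
Implicit Types (D eta eps : R).

(* Here w is (l+1)-uniform.  If the picked vertices have heavy links, recurse
   on these: I contains no edge of them either.  Otherwise every vertex of I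
   that was not picked has small degree, whereas the average degree is large. *)
Fixpoint cont (l : nat) W w (D eta : R) I : {set V} * {set V} :=
  if l is l'.+1 then
    let x := run p w D L I in
    let eta' := eta / 2 ^+ (l + 3) in
    if eta' * (2 * D * p) * N <= wdeg x.2 set0
    then let y := cont l' W x.2 (2 * D * p) eta' I in (x.1 :|: y.1, y.2)
    else (x.1, [set v in W | wdeg (avail p w D x) [set v] <= 2 * eta' * D])
  else (set0, [set v in W | w [set v] == 0]).

(** The fraction of N that one call of [cont] removes from W. The level at which the recursion stops
    depends on I, hence the minimum over all levels. *)
Fixpoint cont_gain (l : nat) (eta : R) : R :=
  if l is l'.+1 then Num.min (eta / 4) (cont_gain l' (eta / 2 ^+ (l + 3)))
  else eta.

Lemma cont_gain_gt0 l eta : 0 < eta -> 0 < cont_gain l eta.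
Proof.
elim: l eta => //= l IH eta eta0; rewrite lt_min IH ?divr_gt0 ?exprn_gt0 //.
Qed.

Lemma cont_stable l W w D eta I J :
  (cont l W w D eta I).1 \subset J -> J \subset I ->
  cont l W w D eta J = cont l W w D eta I.
Proof.
elim: l w D eta => //= l IH w D eta sJ JI.
have rJ : run p w D L J = run p w D L I.
  apply: run_stable => //; move: sJ; case: ifP => _ //=.
  exact: subset_trans (subsetUl _ _).
rewrite rJ; case: ifP sJ => // _ sJ; rewrite IH //.
exact: subset_trans (subsetUr _ _) sJ.
Qed.

Lemma cont_spec l W w D eta I :
  0 < D -> 0 < eta -> #|W|%:R <= N ->
  (forall E, 0 <= w E) -> (forall E, w E != 0 -> #|E| = l.+1 /\ E \subset W) ->
  (forall T, T != set0 -> wdeg w T <= D * p ^+ #|T|.-1) ->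
  eta * D * N <= wdeg w set0 ->
  (forall E, E \subset I -> w E = 0) ->
  let y := cont l W w D eta I in
  [/\ y.1 \subset I, (#|y.1| <= l * L)%N, I :&: W \subset y.1 :|: y.2,
      y.2 \subset W & #|y.2|%:R <= #|W|%:R - cont_gain l eta * N].
Proof.
move=> + + WN; elim: l w D eta => [|l IH] w D eta D0 eta0 w0 wW wD wtot wI /=.
  split; rewrite ?sub0set ?cards0 //.
  - apply/subsetP => v; rewrite !inE => /andP[vI ->] /=.
    by rewrite wI ?eqxx // sub1set.
  - by apply/subsetP => v; rewrite inE => /andP[].
  (* A 1-uniform w with all degrees at most D spreads its weight eta D N over at least eta N
     vertices, none of which lies in I. *)
  have le1 : wdeg w set0 <= \sum_(v in W :\: [set v in W | w [set v] == 0]) D.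
    apply: (@le_trans _ _ (\sum_(v in W :\: [set v in W | w [set v] == 0]) wdeg w [set v])).
      rewrite wdeg0E -[leRHS]addr0.
      have -> : \sum_E w E = \sum_(v in W) wdeg w [set v].
        rewrite sum_wdeg1; apply: eq_bigr => E _.
        have [->|/wW[E1 EW]] := eqVneq (w E) 0; first by rewrite mulr0.
        by rewrite (setIidPl EW) E1 mul1r.
      rewrite [leLHS](big_setID [set v in W | w [set v] == 0]) /= addrC lerD //.
      rewrite big1 // => v; rewrite !inE => /and3P[_ vW /eqP wv0].
      apply: big1 => E vE; have [//|/wW[/eqP/cards1P[u Eu] _]] := eqVneq (w E) 0.
      by move: vE; rewrite Eu sub1set inE => /eqP<-.
    apply: ler_sum => v _; have := wD [set v]; rewrite cards1 mulr1; apply.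
    by rewrite -cards_eq0 cards1.
  move: le1; rewrite sumr_const -[leRHS]mulr_natr.
  set C := [set v in W | w [set v] == 0]; have CW : C \subset W.
    by apply/subsetP => v; rewrite inE => /andP[].
  rewrite cardsD (setIidPr CW) natrB ?subset_leq_card // => /(le_trans wtot).
  by rewrite [eta * D]mulrC -mulrA ler_pM2l //; lra.
set x := run p w D L I; set eta' := eta / 2 ^+ (l.+1 + 3).
have eta'0 : 0 < eta' by rewrite divr_gt0 ?exprn_gt0.
have pow : 2 ^+ (l.+1 + 3) = 16 * 2 ^+ l :> R by rewrite addSn addn3 !exprS; ring.
have etaE : eta = eta' * (16 * 2 ^+ l) by rewrite /eta' -pow divfK // expf_neq0 // pnatr_eq0.
clearbody eta'.
have xI : x.1 \subset I by apply: run_sub.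
have xL : (#|x.1| <= L)%N by apply: run_card.
have x0 E : 0 <= x.2 E by apply: run_ge0.
have xW E : x.2 E != 0 -> #|E| = l.+1 /\ E \subset W.
  move=> /run_neq0[v]; rewrite inE => /andP[vE vI] /wW[].
  rewrite cardsU1 vE add1n => -[->]; rewrite subUset => /andP[_ ->]; split=> //.
case: ifPn => [big|]; last rewrite -ltNge => small.
  (* The links form an instance of uniformity one lower, with 2 D p for D by [run_deg]; an edge of a
     link inside I would, with its pick, be an edge of w inside I. *)
  have D'0 : 0 < 2 * D * p by rewrite !mulr_gt0.
  have xD T : T != set0 -> wdeg x.2 T <= 2 * D * p * p ^+ #|T|.-1.
    by move=> T0; apply: run_deg.
  have xI0 E : E \subset I -> x.2 E = 0.
    move=> EI; apply/eqP/negPn/negP => /run_neq0[v /setDP[vI _]].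
    by rewrite wI ?eqxx // subUset sub1set vI.
  have := IH x.2 (2 * D * p) eta' D'0 eta'0 x0 xW xD big xI0; cbv zeta; case.
  set y := cont _ _ _ _ _ _ => yI yL IWy yW yC /=; split=> //.
  - by rewrite subUset xI.
  - by rewrite mulSn (leq_trans (leq_card_setU _ _)) // leq_add.
  - by rewrite -setUA (subset_trans IWy) // subsetUr.
  - apply: le_trans yC _; by rewrite lerD2l lerN2 ler_wpM2r ?(ltW N_gt0) //= ge_min lexx orbT.
rewrite /=; set C := [set v in W | _].
have CW : C \subset W by apply/subsetP => v; rewrite inE => /andP[].
have av0 := avail_ge0 p D w0 x.
split=> //.
- by rewrite mulSn (leq_trans xL) // leq_addr.
- apply/subsetP => v /setIP[vI vW]; rewrite !inE vW /=.
  have [//|vx] := boolP (v \in x.1); rewrite /=.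
  (* As L >= p N, dividing the small total weight of the links by L leaves an available degree of at
     most 2 eta' D. *)
  have := @run_max p w D w0 L I v; rewrite !inE vx vI => /(_ isT).
  rewrite -/x => le1; rewrite -(ler_pM2r (mulr_gt0 p_gt0 N_gt0)).
  apply: le_trans (_ : L%:R * wdeg (avail p w D x) [set v] <= _).
    by rewrite mulrC ler_wpM2r // wdeg_ge0.
  apply: (le_trans le1); apply: (le_trans (ltW small)).
  by rewrite le_eqVlt; apply/orP; left; apply/eqP; ring.
have P1 : 1 <= 2 ^+ l :> R by rewrite exprn_ege1 // ler1n.
have sat_le : \sum_(E : {set V} | ~~ unsat p D x.2 E) w E <= eta' * 4 * 2 ^+ l * (D * N).
  rewrite -(ler_pM2l p_gt0).
  apply: le_trans (@unsat_total p w D p_gt0 w0 x.2 l.+1 x0 _ wD) _.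
    by move=> E /xW[].
  have : 2 ^+ l.+1 * wdeg x.2 set0 <= 2 ^+ l.+1 * (eta' * (2 * D * p) * N).
    by rewrite ler_wpM2l ?exprn_ge0 // ltW.
  by move/le_trans; apply; rewrite le_eqVlt; apply/orP; left; apply/eqP; rewrite exprS; ring.
have meet_le := @run_meets p w D w0 L I; rewrite -/x in meet_le.
have DN0 : 0 < D * N by rewrite mulr_gt0.
have small' : wdeg x.2 set0 <= eta' * 2 * (D * N).
  apply: (le_trans (ltW small)).
  have -> : eta' * (2 * D * p) * N = p * (eta' * 2 * (D * N)) by ring.
  by rewrite ler_piMl ?mulr_ge0 // ltW.
have tot_le : wdeg w set0 <= \sum_(E : {set V} | ~~ unsat p D x.2 E) w E
   + wdeg x.2 set0 + wdeg (avail p w D x) set0.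
  apply: le_trans (lerD (lerD (lexx _) meet_le) (lexx _)).
  rewrite !wdeg0E big_mkcond [X in _ <= X + _ + _]big_mkcond.
  rewrite [X in _ <= _ + X + _]big_mkcond -!big_split /=; apply: ler_sum => E _.
  rewrite /avail; case: (unsat _ _ _ _) => /=; rewrite ?andbT ?andbF ?addr0 //.
  by case: [disjoint _ & _] => /=; rewrite ?add0r ?addr0.
have deg_le : wdeg (avail p w D x) set0 <=
    \sum_(v in W) wdeg (avail p w D x) [set v].
  rewrite wdeg0E sum_wdeg1; apply: ler_sum => E _.
  have [->|] := eqVneq (avail p w D x E) 0; first by rewrite mulr0.
  rewrite {1}/avail; case: ifP; rewrite ?eqxx // => _ /wW[E1 EW].
  by rewrite (setIidPl EW) E1 ler_peMl // ler1n.
have C_le : \sum_(v in C) wdeg (avail p w D x) [set v] <= N * (2 * eta' * D).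
  apply: (@le_trans _ _ (\sum_(v in C) 2 * eta' * D)).
    by apply: ler_sum => v; rewrite inE => /andP[].
  rewrite sumr_const -[leLHS]mulr_natl ler_wpM2r ?mulr_ge0 ?(ltW eta'0) ?(ltW D0) //.
  by apply: le_trans WN; rewrite ler_nat subset_leq_card.
have WC_le : \sum_(v in W :\: C) wdeg (avail p w D x) [set v] <= (#|W|%:R - #|C|%:R) * D.
  apply: (@le_trans _ _ (\sum_(v in W :\: C) D)).
    apply: ler_sum => v _; apply: le_trans (wdegS _ (avail_le p D w0 x)) _.
    by have := wD [set v]; rewrite cards1 mulr1; apply; rewrite -cards_eq0 cards1.
  by rewrite sumr_const -[leLHS]mulr_natl cardsD (setIidPr CW) natrB ?subset_leq_card.
(* In units of eta' D N the total is at least 16 2^l. Saturated edges account for 4 2^l, edges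
   meeting the picks for 2, and vertices of C for 2. At least 8 2^l is left to vertices outside C,
   each of degree at most D; the gain eta / 4 claims half of that. *)
have key : eta * D * N <= eta' * 4 * 2 ^+ l * (D * N) + eta' * 2 * (D * N)
    + (N * (2 * eta' * D) + (#|W|%:R - #|C|%:R) * D).
  apply: (le_trans wtot); apply: (le_trans tot_le); apply: lerD; first exact: lerD.
  apply: (le_trans deg_le); rewrite (big_setID C) /= (setIidPr CW); exact: lerD.
have {key} : eta / 4 * N <= #|W|%:R - #|C|%:R.
  rewrite -(ler_pM2r D0); move: key; rewrite etaE.
  have : 0 <= (2 ^+ l - 1) * (eta' * (D * N)) by rewrite mulr_ge0 ?subr_ge0 // mulr_ge0 ?ltW.
  have : 0 < eta' * (D * N) by rewrite !mulr_gt0.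
  set P := 2 ^+ l; move: P => P.
  have -> : eta' * (16 * P) * D * N = 16 * (P * (eta' * (D * N))) by ring.
  have -> : eta' * 4 * P * (D * N) = 4 * (P * (eta' * (D * N))) by ring.
  have -> : eta' * (16 * P) / 4 * N * D = 4 * (P * (eta' * (D * N))) by field.
  have -> : (P - 1) * (eta' * (D * N)) = P * (eta' * (D * N)) - eta' * (D * N) by ring.
  have -> : eta' * 2 * (D * N) = 2 * (eta' * (D * N)) by ring.
  have -> : N * (2 * eta' * D) = 2 * (eta' * (D * N)) by ring.
  lra.
have : Num.min (eta / 4) (cont_gain l eta') * N <= eta / 4 * N.
  by rewrite ler_wpM2r ?(ltW N_gt0) // ge_min lexx.
lra.
Qed.

(** While W still carries weight eps D N, [cont] applies to w restricted to W and removes a fixed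
    fraction of N, so a number of rounds depending only on l and eps suffices. *)
Fixpoint citer (l k : nat) w (D eps : R) W I : {set V} * {set V} :=
  if k is k'.+1 then
    let wW E := if E \subset W then w E else 0 in
    if eps * D * N <= wdeg wW set0 then
      let y := cont l W wW D eps I in
      let z := citer l k' w D eps y.2 I in (y.1 :|: z.1, z.2)
    else (set0, W)
  else (set0, W).

Lemma citer_stable l k w D eps W I J :
  (citer l k w D eps W I).1 \subset J -> J \subset I ->
  citer l k w D eps W J = citer l k w D eps W I.
Proof.
elim: k W => //= k IH W; case: ifP => // _ /= sJ JI.
have e1 : cont l W (fun E => if E \subset W then w E else 0) D eps J =
    cont l W (fun E => if E \subset W then w E else 0) D eps I.
  by apply: cont_stable => //; apply: subset_trans sJ; apply: subsetUl.
by rewrite e1 IH //; apply: subset_trans sJ; apply: subsetUr.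
Qed.

Lemma citer_spec l k w D eps W I :
  0 < D -> 0 < eps -> #|W|%:R <= N ->
  (forall E, 0 <= w E) -> (forall E, w E != 0 -> #|E| = l.+1) ->
  (forall T, T != set0 -> wdeg w T <= D * p ^+ #|T|.-1) ->
  (forall E, E \subset I -> w E = 0) ->
  #|W|%:R <= k%:R * (cont_gain l eps * N) ->
  let y := citer l k w D eps W I in
  [/\ y.1 \subset I, (#|y.1| <= k * (l * L))%N, I :&: W \subset y.1 :|: y.2 &
      \sum_(E : {set V} | E \subset y.2) w E < eps * D * N].
Proof.
move=> D0 eps0 + w0 wl wD wI; elim: k W => [|k IH] W WN Wk /=.
  split; rewrite ?sub0set ?cards0 //; first by rewrite set0U subsetIr.
  (* Running out of rounds forces W to be empty; what remains is [w set0], which vanishes by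
     uniformity. *)
  have W0' : W = set0.
    by apply/eqP; rewrite -cards_eq0 -leqn0 -(ler_nat R); move: Wk; rewrite mul0r.
  rewrite big1 ?mulr_gt0 // => E; rewrite W0' subset0 => /eqP->.
  by have [//|/wl] := eqVneq (w set0) 0; rewrite cards0.
set wW := fun E : {set V} => if E \subset W then w E else 0.
case: ifPn => [big|]; last first.
  rewrite -ltNge => small; split; rewrite ?sub0set ?cards0 //=.
    by rewrite set0U subsetIr.
  by move: small; rewrite wdeg0E /wW -big_mkcond.
have wWw E : wW E <= w E by rewrite /wW; case: ifP.
have wW0 E : 0 <= wW E by rewrite /wW; case: ifP.
have wWl E : wW E != 0 -> #|E| = l.+1 /\ E \subset W.
  by rewrite /wW; case: ifP; rewrite ?eqxx // => _ /wl.
have wWD T : T != set0 -> wdeg wW T <= D * p ^+ #|T|.-1.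
  by move=> T0; apply: le_trans (wD T T0); apply: wdegS.
have wWI E : E \subset I -> wW E = 0 by move=> /wI wE; rewrite /wW wE; case: ifP.
have := @cont_spec l W wW D eps I D0 eps0 WN wW0 wWl wWD big wWI; cbv zeta; case.
set y := cont _ _ _ _ _ _ => yI yL IWy yW yC.
have y2N : #|y.2|%:R <= N.
  by apply: le_trans WN; rewrite ler_nat subset_leq_card.
have y2k : #|y.2|%:R <= k%:R * (cont_gain l eps * N).
  by move: Wk; rewrite -natr1 mulrDl mul1r; lra.
have [zI zL Iz zw] := IH y.2 y2N y2k.
set z := citer _ _ _ _ _ _ _ in zI zL Iz zw *; split=> //=.
- by rewrite subUset yI.
- by rewrite mulSn (leq_trans (leq_card_setU _ _)) // leq_add.
- apply/subsetP => v vIW; have /setUP[vy|vy] := subsetP IWy v vIW.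
    by rewrite !inE vy.
  rewrite -setUA inE (subsetP Iz) ?orbT // inE vy andbT.
  by have /setIP[] := vIW.
Qed.

End Cont.

(** The map f is chosen before I: rerunning the algorithm on the fingerprint S alone repeats its run
    on I by [citer_stable], so the container is a function of S. *)
Theorem containers (l k : nat) (eps p N D : R) (L : nat) w W :
  0 < eps -> 1 <= k%:R * cont_gain l eps ->
  0 < p -> p <= 1 -> 0 < N -> p * N <= L%:R -> 0 < D -> #|W|%:R <= N ->
  (forall E, 0 <= w E) -> (forall E, w E != 0 -> #|E| = l.+1) ->
  (forall T, T != set0 -> wdeg w T <= D * p ^+ #|T|.-1) ->
  exists f : {set V} -> {set V}, forall I, (forall E, E \subset I -> w E = 0) ->
  exists S, [/\ S \subset I, (#|S| <= k * (l * L))%N, I :&: W \subset S :|: f S &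
      \sum_(E : {set V} | E \subset f S) w E < eps * D * N].
Proof.
move=> eps0 kg p0 p1 N0 pNL D0 WN w0 wl wD.
pose C I := citer p N L l k w D eps W I.
exists (fun S => (C S).2) => I wI; exists (C I).1.
have Wk : #|W|%:R <= k%:R * (cont_gain l eps * N).
  by apply: le_trans WN _; rewrite mulrA ler_peMl // ltW.
have := citer_spec p0 p1 N0 pNL D0 eps0 WN w0 wl wD wI Wk; cbv zeta => -[CI CL IC Cw].
by rewrite /C (citer_stable (subxx _) CI) -/(C I).
Qed.

End Containers.

(** * Random sets and Janson's inequality *)

Section RandomSet.
Variables (R : realType) (V : finType).
Implicit Types (q : V -> R) (f g : {set V} -> R) (A B X Y : {set V}) (v : V).

Lemma ler_bool (a b : bool) : (a -> b) -> a%:R <= b%:R :> R.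
Proof. by case: a; case: b => // /(_ isT). Qed.

Definition mu q X : R := \prod_(v : V) (if v \in X then q v else 1 - q v).
Definition Ex q f : R := \sum_(X : {set V}) mu q X * f X.

Definition mu_off q v X : R :=
  \prod_(u : V | u != v) (if u \in X then q u else 1 - q u).

(** Exposes the single coordinate v, by pairing X with [v |: X]; conditioning and monotonicity both
    come from this. *)
Lemma Ex_pair q v f : Ex q f =
  \sum_(X : {set V} | v \notin X) mu_off q v X * (q v * f (v |: X) + (1 - q v) * f X).
Proof.
rewrite /Ex (bigID (fun X => v \in X)) /=.
rewrite (reindex_onto (fun X => v |: X) (fun X => X :\ v)) /=; last first.
  by move=> X vX; rewrite setD1K.
rewrite (eq_bigl (fun X => v \notin X)); last first.
  move=> X; rewrite setU11 /=; apply/eqP/idP => [<-|vX]; first by rewrite !inE eqxx.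
  by rewrite setU1K.
rewrite -big_split /=; apply: eq_bigr => X vX.
rewrite /mu (bigD1 v) //= [in X in _ + X](bigD1 v) //= setU11 (negbTE vX).
rewrite (eq_bigr (fun u => if u \in X then q u else 1 - q u)); last first.
  by move=> u uv; rewrite !inE (negbTE uv).
by rewrite /mu_off; ring.
Qed.

Lemma Ex_split q v f : Ex q f =
  q v * Ex q (fun X => f (v |: X)) + (1 - q v) * Ex q (fun X => f (X :\ v)).
Proof.
rewrite !(Ex_pair q v) !mulr_sumr -big_split /=; apply: eq_bigr => X vX.
by rewrite setUA setUid setU1K // (setDidPl _) ?disjoints1 // 1?disjoint_sym ?disjoints1 //; ring.
Qed.

Lemma Ex_cst q c : Ex q (fun=> c) = c.
Proof.
rewrite /Ex -mulr_suml -[RHS]mul1r; congr (_ * _).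
rewrite /mu -(bigA_distr _ _ (fun v => q v) (fun v => 1 - q v)) big1 // => v _.
by rewrite /= addrC subrK.
Qed.

Lemma eq_Ex q f g : f =1 g -> Ex q f = Ex q g.
Proof. by move=> fg; apply: eq_bigr => X _; rewrite fg. Qed.

Lemma ExD q f g : Ex q (fun X => f X + g X) = Ex q f + Ex q g.
Proof. by rewrite /Ex -big_split /=; apply: eq_bigr => X _; rewrite mulrDr. Qed.

Lemma ExZ q c f : Ex q (fun X => c * f X) = c * Ex q f.
Proof. by rewrite /Ex mulr_sumr; apply: eq_bigr => X _; rewrite mulrCA. Qed.

Lemma Ex_sum q (I : Type) (r : seq I) (P : pred I) (F : I -> {set V} -> R) :
  Ex q (fun X => \sum_(i <- r | P i) F i X) = \sum_(i <- r | P i) Ex q (F i).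
Proof. by rewrite /Ex exchange_big /=; apply: eq_bigr => X _; rewrite mulr_sumr. Qed.

Definition prodset q A : R := \prod_(v in A) q v.

(** Conditioning on [A \subset X] amounts to adding A to a fresh random set. For f depending only on
    elements outside A this is independence; for decreasing f it yields the correlation inequality
    needed below. *)
Lemma Ex_contain q A f :
  Ex q (fun X => (A \subset X)%:R * f X) = prodset q A * Ex q (fun X => f (A :|: X)).
Proof.
have [n] := ubnP #|A|; elim: n A f => // n IH A f.
have [->|[v vA]] := set_0Vmem A.
  rewrite /prodset big_set0 mul1r => _; apply: eq_Ex => X.
  by rewrite sub0set set0U mul1r.
rewrite -(setD1K vA) cardsU1 !inE eqxx /= add1n ltnS => An.
rewrite (Ex_split q v) /prodset big_setU1 ?inE ?eqxx //= -/(prodset q _) -mulrA.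
have -> : Ex q (fun X => (v |: (A :\ v) \subset X :\ v)%:R * f (X :\ v)) = 0.
  rewrite -(mul0r (Ex q (fun=> 0))) -ExZ; apply: eq_Ex => X.
  by rewrite subUset sub1set !inE eqxx mul0r mul0r.
rewrite mulr0 addr0; congr (_ * _).
rewrite -(eq_Ex q (f := fun X => (A :\ v \subset X)%:R * f (v |: X))); last first.
  move=> X; congr ((nat_of_bool _)%:R * _); rewrite subUset sub1set setU11 /=.
  apply/idP/idP => [AX|/subsetP AX]; first by rewrite (subset_trans AX) ?subsetUr.
  apply/subsetP => u uA; have := AX u uA; move: uA; rewrite !inE => /andP[/negbTE-> _].
  by [].
by rewrite IH //; congr (_ * _); apply: eq_Ex => X; rewrite setUA.
Qed.

Section Prob.
Variable q : V -> R.
Hypothesis q01 : forall v, 0 <= q v <= 1.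

Lemma mu_off_ge0 v X : 0 <= mu_off q v X.
Proof.
by apply: prodr_ge0 => u _; have /andP[? ?] := q01 u; case: ifP; rewrite ?subr_ge0.
Qed.

Lemma mu_ge0 X : 0 <= mu q X.
Proof.
by apply: prodr_ge0 => u _; have /andP[? ?] := q01 u; case: ifP; rewrite ?subr_ge0.
Qed.

Lemma le_Ex f g : (forall X, f X <= g X) -> Ex q f <= Ex q g.
Proof. by move=> fg; apply: ler_sum => X _; rewrite ler_wpM2l ?mu_ge0. Qed.

Lemma Ex_ge0 f : (forall X, 0 <= f X) -> 0 <= Ex q f.
Proof. by move=> f0; apply: sumr_ge0 => X _; rewrite mulr_ge0 ?mu_ge0. Qed.

Lemma prodset_ge0 A : 0 <= prodset q A.
Proof. by apply: prodr_ge0 => u _; have /andP[] := q01 u. Qed.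

Lemma Ex_containE A : Ex q (fun X => (A \subset X)%:R) = prodset q A.
Proof.
transitivity (Ex q (fun X => (A \subset X)%:R * (fun=> 1) X)).
  by apply: eq_Ex => X; rewrite mulr1.
by rewrite Ex_contain Ex_cst mulr1.
Qed.

Definition none (s : seq {set V}) X : bool := all (fun A => ~~ (A \subset X)) s.

Lemma none_anti s X Y : X \subset Y -> none s Y -> none s X.
Proof.
move=> XY /allP sY; apply/allP => A As; apply: contra (sY A As) => AX.
exact: subset_trans AX XY.
Qed.

Definition clash A : pred {set V} := fun B => ~~ [disjoint A & B].

(** The event C that no member of s disjoint from A lies in X is independent of [A \subset X]. If
    both hold, either no member of s lies in X, or some B clashing with A does, which costs at most
    [prodset q (A :|: B) * c] as C is decreasing. Since c >= P, a fraction [prodset q A - D] of P is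
    lost. *)
Lemma janson_step A s : Ex q (fun X => (none (A :: s) X)%:R) <=
  Ex q (fun X => (none s X)%:R) *
  expR (- prodset q A + \sum_(B <- s | clash A B) prodset q (A :|: B)).
Proof.
set D := \sum_(B <- _ | _) _.
set P := Ex q (fun X => (none s X)%:R).
have P0 : 0 <= P by apply: Ex_ge0 => X; rewrite ler0n.
pose C := none [seq B : {set V} <- s | [disjoint A & B]].
pose c := Ex q (fun X => (C X)%:R).
have Pc : P <= c.
  apply: le_Ex => X; apply: ler_bool => /allP sX.
  by apply/allP => B; rewrite mem_filter => /andP[_ /sX].
have AC : Ex q (fun X => (A \subset X)%:R * (C X)%:R) = prodset q A * c.
  rewrite Ex_contain; congr (_ * _); apply: eq_Ex => X; congr (_%:R).
  rewrite /C /none; congr nat_of_bool; apply: eq_in_all => B; rewrite mem_filter => /andP[AB _].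
  congr (~~ _); apply/idP/idP => [/subsetP BAX|/subset_trans]; last by apply; apply: subsetUr.
  apply/subsetP => v vB; have := BAX v vB; rewrite inE => /orP[vA|//].
  by rewrite (disjointFr AB vA) in vB.
have key : prodset q A * c <= Ex q (fun X => ((A \subset X) && none s X)%:R) + D * c.
  rewrite -AC /D mulr_suml.
  apply: (@le_trans _ _ (Ex q (fun X => ((A \subset X) && none s X)%:R) +
      \sum_(B <- s | clash A B) Ex q (fun X => (A :|: B \subset X)%:R * (C X)%:R))).
    rewrite -Ex_sum -ExD; apply: le_Ex => X.
    have [AX|] := boolP (A \subset X); last first.
      by move=> _; rewrite mul0r add0r; apply: sumr_ge0 => B _; rewrite mulr_ge0 ?ler0n.
    have [CX|] := boolP (C X); last first.
      by move=> _; rewrite mulr0 addr_ge0 ?ler0n //; apply: sumr_ge0 => B _; rewrite mulr_ge0 ?ler0n.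
    have [nX|/allPn[B Bs]] := boolP (none s X); first by rewrite /= mulr1 lerDl; apply: sumr_ge0 => B _; rewrite mulr_ge0 ?ler0n.
    rewrite negbK => BX; rewrite (big_rem B) //= add0r.
    have -> : clash A B.
      apply/negP => AB; have /allP/(_ B) := CX; rewrite mem_filter AB Bs => /(_ isT).
      by rewrite BX.
    rewrite subUset AX BX lerDl; apply: sumr_ge0 => B' _; by rewrite mulr_ge0 ?ler0n.
  rewrite lerD2l; apply: ler_sum => B _; rewrite Ex_contain ler_wpM2l ?prodset_ge0 //.
  by apply: le_Ex => X; apply: ler_bool; apply: none_anti; apply: subsetUr.
have -> : Ex q (fun X => (none (A :: s) X)%:R) =
    P - Ex q (fun X => ((A \subset X) && none s X)%:R).
  apply/(canRL (addrK _)); rewrite -ExD; apply: eq_Ex => X /=.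
  by case: (A \subset X); rewrite ?add0r ?addr0.
apply: le_trans (_ : P * (1 + (- prodset q A + D)) <= _); last first.
  by rewrite ler_wpM2l // expR_ge1Dx.
have : 0 <= Ex q (fun X => ((A \subset X) && none s X)%:R).
  by apply: Ex_ge0 => X; rewrite ler0n.
move: key; set E := Ex q _ => key E0.
(* Replacing c by the smaller P is allowed when the factor [prodset q A - D] is nonnegative;
   otherwise the claimed bound is already at least P. *)
have [le|/ltW le] := lerP D (prodset q A).
  have : 0 <= (c - P) * (prodset q A - D) by rewrite mulr_ge0 // subr_ge0.
  by lra.
have : 0 <= P * (D - prodset q A) by rewrite mulr_ge0 // subr_ge0.
by lra.
Qed.

(* The sum over ordered pairs is twice what Janson's inequality needs. *)
Lemma janson s : uniq s -> Ex q (fun X => (none s X)%:R) <=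
  expR (- (\sum_(A <- s) prodset q A) +
    \sum_(A <- s) \sum_(B <- s | (B != A) && clash A B) prodset q (A :|: B)).
Proof.
elim: s => [_|A s IH /= /andP[As us]].
  by rewrite !big_nil oppr0 addr0 expR0 Ex_cst.
apply: (le_trans (janson_step A s)).
apply: (le_trans (ler_wpM2r (expR_ge0 _) (IH us))); rewrite -expRD ler_expR.
rewrite !big_cons eqxx /=.
have -> : \sum_(B <- s | (B != A) && clash A B) prodset q (A :|: B) =
    \sum_(B <- s | clash A B) prodset q (A :|: B).
  rewrite big_seq_cond [RHS]big_seq_cond; apply: eq_bigl => B.
  by case: (boolP (B \in s)) => //= Bs; case: eqP => // BA; rewrite -BA Bs in As.
suff : \sum_(B <- s) \sum_(C <- s | (C != B) && clash B C) prodset q (B :|: C) <=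
  \sum_(B <- s) \sum_(C <- A :: s | (C != B) && clash B C) prodset q (B :|: C) by lra.
apply: ler_sum => B _; rewrite big_cons; case: ifP => // _.
by rewrite lerDr prodset_ge0.
Qed.

Lemma markov_Ex f (b : R) : (forall X, 0 <= f X) -> 0 < b ->
  Ex q (fun X => (b < f X)%R%:R) <= Ex q f / b.
Proof.
move=> f0 b0; rewrite mulrC -ExZ; apply: le_Ex => X.
case: ltP => [|_]; last by rewrite mulr_ge0 // invr_ge0 ltW.
by rewrite mulrC ler_pdivlMr // mul1r => /ltW.
Qed.

End Prob.

(** The hybrid [h s] has the new probabilities on s and the old ones elsewhere; raising one
    coordinate at a time reduces the claim to [Ex_pair]. *)
Lemma Ex_mono q q' f : (forall v, 0 <= q v <= 1) -> (forall v, 0 <= q' v <= 1) ->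
  (forall v, q v <= q' v) -> (forall X Y, X \subset Y -> f X <= f Y) ->
  Ex q f <= Ex q' f.
Proof.
move=> q01 q'01 qq' fmono.
pose h (s : seq V) v := if v \in s then q' v else q v.
have h01 s v : 0 <= h s v <= 1 by rewrite /h; case: ifP.
have -> : Ex q' f = Ex (h (enum V)) f.
  by apply: eq_bigr => X _; congr (_ * _); apply: eq_bigr => v _; rewrite /h mem_enum.
elim: (enum V) => [|v s IH]; first exact: lexx.
apply: (le_trans IH); rewrite !(Ex_pair _ v); apply: ler_sum => X vX.
have -> : mu_off (h (v :: s)) v X = mu_off (h s) v X.
  by apply: eq_bigr => u uv; rewrite /h inE (negbTE uv).
rewrite ler_wpM2l ?mu_off_ge0 //.
have le1 : h s v <= h (v :: s) v by rewrite /h inE eqxx; case: ifP.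
have : 0 <= (h (v :: s) v - h s v) * (f (v |: X) - f X).
  by rewrite mulr_ge0 // subr_ge0 // fmono // subsetUr.
by lra.
Qed.

End RandomSet.

(** * Ramsey supersaturation and copies of a graph *)

Section Ramsey.
Local Open Scope nat_scope.

(** The Erdős-Szekeres argument: one of the two colour neighbourhoods of a vertex keeps half of the
    points, and one of a, b drops. *)
Lemma ramsey_clique (Y : finType) (c : pred {set Y}) (a b : nat) (S : {set Y}) :
  2 ^ (a + b) <= #|S| ->
  (exists K : {set Y}, [/\ K \subset S, #|K| = a &
     {in K &, forall x y, x != y -> c [set x; y]}]) \/
  (exists K : {set Y}, [/\ K \subset S, #|K| = b &
     {in K &, forall x y, x != y -> ~~ c [set x; y]}]).
Proof.
have [m] := ubnP (a + b); elim: m a b S => // m IH [|a] b S.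
  by move=> _ _; left; exists set0; split; rewrite ?sub0set ?cards0 // => x y; rewrite inE.
case: b => [|b].
  by move=> _ _; right; exists set0; split; rewrite ?sub0set ?cards0 // => x y; rewrite inE.
move=> abm Sab.
have /card_gt0P[x xS] : 0 < #|S| by apply: leq_trans Sab; rewrite expn_gt0.
pose S1 := [set y in S :\ x | c [set x; y]].
pose S0 := [set y in S :\ x | ~~ c [set x; y]].
have S10 : #|S :\ x| = #|S1| + #|S0|.
  rewrite -(cardsID [set y | c [set x; y]] (S :\ x)); congr (_ + _);
    by apply: eq_card => y; rewrite !inE // andbC.
have Sx : #|S| = (#|S :\ x|).+1 by rewrite (cardsD1 x) xS.
have S1S : S1 \subset S by apply/subsetP => y; rewrite !inE => /andP[/andP[]].
have S0S : S0 \subset S by apply/subsetP => y; rewrite !inE => /andP[/andP[]].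
have add1 (K : {set Y}) (P : pred {set Y}) k : #|K| = k -> K \subset S ->
    {in K, forall y, y != x /\ P [set x; y]} ->
    {in K &, forall u v, u != v -> P [set u; v]} ->
    exists K : {set Y}, [/\ K \subset S, #|K| = k.+1 &
     {in K &, forall x y, x != y -> P [set x; y]}].
  move=> Kk KS Kx KP; exists (x |: K); split.
  - by rewrite subUset sub1set xS.
  - rewrite cardsU1 Kk; case: (boolP (x \in K)) => // /Kx[]; by rewrite eqxx.
  - move=> u v; rewrite !inE => /orP[/eqP->|uK] /orP[/eqP->|vK]; rewrite ?eqxx //.
    + by have [] := Kx v vK.
    + by rewrite setUC; have [] := Kx u uK.
    + exact: KP.
have [le1|lt1] := leqP (2 ^ (a + b.+1)) #|S1|.
  have [|[K [KS Kk KP]]|[K [KS Kk KP]]] := IH a b.+1 S1 _ le1; first by lia.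
    left; apply: (add1 K) => //; first exact: subset_trans KS S1S.
    by move=> y /(subsetP KS); rewrite !inE => /andP[/andP[]].
  by right; exists K; split=> //; apply: subset_trans KS S1S.
have le0 : 2 ^ (a.+1 + b) <= #|S0|.
  move: Sab lt1; rewrite Sx S10 !addnS !addSn !expnS; lia.
have [|[K [KS Kk KP]]|[K [KS Kk KP]]] := IH a.+1 b S0 _ le0; first by lia.
  by left; exists K; split=> //; apply: subset_trans KS S0S.
right; apply: (add1 K (fun e => ~~ c e)) => //; first exact: subset_trans KS S0S.
by move=> y /(subsetP KS); rewrite !inE => /andP[/andP[]].
Qed.

Lemma set_embedding (A Y : finType) (K : {set Y}) : #|K| = #|A| ->
  exists2 f : {ffun A -> Y}, injective f & forall x, f x \in K.
Proof.
move=> KA; exists [ffun x => enum_val (cast_ord (esym KA) (enum_rank x))].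
  move=> x y; rewrite !ffunE => /enum_val_inj/cast_ord_inj; exact: enum_rank_inj.
by move=> x; rewrite ffunE enum_valP.
Qed.

Lemma ramsey (A B : finType) (EA : {set {set A}}) (EB : {set {set B}}) :
  (forall e, e \in EA -> #|e| = 2) -> (forall e, e \in EB -> #|e| = 2) ->
  forall c : pred {set 'I_(2 ^ (#|A| + #|B|))},
  (exists2 f : {ffun A -> _}, injective f & forall e, e \in EA -> c (f @: e)) \/
  (exists2 f : {ffun B -> _}, injective f & forall e, e \in EB -> ~~ c (f @: e)).
Proof.
move=> EA2 EB2 c.
have key (X Y : finType) (EX : {set {set X}}) (P : pred {set Y}) (K : {set Y}) :
    (forall e, e \in EX -> #|e| = 2) -> #|K| = #|X| ->
    {in K &, forall x y, x != y -> P [set x; y]} ->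
    exists2 f : {ffun X -> Y}, injective f & forall e, e \in EX -> P (f @: e).
  move=> EX2 /set_embedding[f fi fK] KP; exists f; first exact: fi.
  move=> e eX; have /eqP/cards2P[x [y [xy ->]]] := EX2 e eX.
  rewrite imsetU1 imset_set1; apply: KP; rewrite ?fK //.
  by apply: contra_neq xy => /fi.
have [|[K [_ KA KP]]|[K [_ KB KP]]] :=
  @ramsey_clique _ c #|A| #|B| [set: 'I_(2 ^ (#|A| + #|B|))].
- by rewrite cardsT card_ord.
- by left; apply: key KP.
- by right; apply: (key _ _ _ (fun e => ~~ c e)) KP.
Qed.

End Ramsey.

(** * Counting maps between finite sets *)

Section Counting.
Local Open Scope nat_scope.

Lemma leq_self_exp a b : a <= b -> a ^ a <= b ^ b.
Proof.
case: a => [|a] ab; first by rewrite expn_gt0; case: b ab.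
apply: (@leq_trans (b ^ a.+1)); first by rewrite leq_exp2r.
by rewrite leq_pexp2l // (leq_trans _ ab).
Qed.

Lemma card_union_bound (T I : finType) (P : pred T) (Q : pred I) (F : I -> pred T) :
  (forall t, P t -> exists2 i, Q i & F i t) -> #|P| <= \sum_(i | Q i) #|F i|.
Proof.
move=> PF; rewrite -sum1_card; under [leqRHS]eq_bigr do rewrite -sum1_card.
rewrite (exchange_big_dep predT) //= big_mkcond /=; apply: leq_sum => t _.
case: ifPn => // /PF[i Qi Fit].
by rewrite (bigD1 i) ?leq_addr //= Qi unfold_in Fit.
Qed.

Lemma sum_nat_const_pred (I : finType) (P : pred I) c : \sum_(i | P i) c = #|P| * c.
Proof. by rewrite -sum_nat_const; apply: eq_bigl. Qed.

Lemma card_ffun_family (A Y : finType) (P : pred {ffun A -> Y}) (F : A -> pred Y) :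
  (forall f, P f -> forall x, F x (f x)) -> #|P| <= \prod_(x : A) #|F x|.
Proof.
move=> PF; rewrite -big_enum -(big_map (fun x => #|F x|) xpredT id) -foldrE.
rewrite -(card_family F); apply: subset_leq_card; apply/subsetP => f fP.
by apply/familyP => x; apply: PF.
Qed.

Lemma card_ffun_constrained (A Y : finType) (P : pred {ffun A -> Y}) (X : {set A})
    (Z : A -> {set Y}) (k : nat) :
  (forall x, x \in X -> #|Z x| <= k) ->
  (forall f, P f -> forall x, x \in X -> f x \in Z x) ->
  #|P| <= k ^ #|X| * #|Y| ^ (#|A| - #|X|).
Proof.
move=> Zk PXZ.
apply: (leq_trans (@card_ffun_family A Y P
   (fun x => [pred y | (x \in X) ==> (y \in Z x)]) _)).
  by move=> f fP x /=; apply/implyP; apply: PXZ.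
rewrite (bigID (fun x => x \in X)) /=.
rewrite [X in _ * X](eq_bigr (fun=> #|Y|)); last first.
  by move=> x xX; apply: eq_card => y; rewrite !inE (negbTE xX).
rewrite [X in _ * X](eq_bigl (mem (~: X))) => [|x]; last by rewrite /= inE.
rewrite !prod_nat_const [#|~: X|]cardsCs setCK leq_mul2r -prod_nat_const.
apply/orP; right; apply: leq_prod => x xX; apply: leq_trans (Zk x xX).
by apply/eq_leq/eq_card => y; rewrite !inE xX.
Qed.

Lemma card_ffun_into (A Y : finType) (P : pred {ffun A -> Y}) (X : {set A}) (Z : {set Y}) :
  (forall f, P f -> forall x, x \in X -> f x \in Z) ->
  #|P| <= #|Z| ^ #|X| * #|Y| ^ (#|A| - #|X|).
Proof. exact: card_ffun_constrained. Qed.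

Lemma card_ffun_extending (A I Y : finType) (phi : {ffun A -> I}) (f : {ffun A -> Y}) :
  injective phi ->
  #|[pred g : {ffun I -> Y} | [forall x, g (phi x) == f x]]| <= #|Y| ^ (#|I| - #|A|).
Proof.
move=> phi_inj.
pose Z u := [set y | [forall x, (phi x == u) ==> (y == f x)]].
have := @card_ffun_constrained I Y
  [pred g : {ffun I -> Y} | [forall x, g (phi x) == f x]] (phi @: setT) Z 1.
rewrite exp1n mul1n card_imset // cardsT; apply.
  move=> _ /imsetP[x _ ->]; rewrite -(cards1 (f x)); apply: subset_leq_card.
  by apply/subsetP => y; rewrite !inE => /forallP/(_ x); rewrite eqxx.
move=> g /forallP gf _ /imsetP[x _ ->]; rewrite inE; apply/forallP => x'.
by apply/implyP => /eqP/phi_inj <-.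
Qed.

Lemma card_ffun_noninj (A Y : finType) :
  #|[pred f : {ffun A -> Y} | ~~ injectiveb f]| <= #|A| ^ 2 * #|Y| ^ #|A|.-1.
Proof.
have key (x y : A) (z : Y) : x != y ->
    #|[pred f : {ffun A -> Y} | (f x == z) && (f y == z)]| <= #|Y| ^ (#|A| - 2).
  move=> xy; have := @card_ffun_into A Y
    [pred f : {ffun A -> Y} | (f x == z) && (f y == z)] [set x; y] [set z].
  rewrite cards1 exp1n mul1n cards2 xy; apply=> f /andP[/eqP fx /eqP fy] u.
  by rewrite !inE => /orP[]/eqP->; rewrite ?fx ?fy.
apply: (@leq_trans (\sum_(u : A * A | u.1 != u.2) \sum_(z : Y)
    #|[pred f : {ffun A -> Y} | (f u.1 == z) && (f u.2 == z)]|)).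
  rewrite pair_big_dep /=; apply: card_union_bound => f /injectivePn[x [y xy fxy]].
  by exists ((x, y), f x); rewrite /= ?xy // fxy eqxx.
apply: (@leq_trans (\sum_(u : A * A | u.1 != u.2) \sum_(z : Y) #|Y| ^ (#|A| - 2))).
  by apply: leq_sum => u uu; apply: leq_sum => z _; apply: key.
(* The exponent [#|A| - 2] is truncated when A has fewer than two points, but then there is no pair
   to collide. *)
have [a1|a1] := leqP #|A| 1.
  rewrite [leqLHS]big_pred0 // => -[x y] /=; apply/negbTE; rewrite negbK; apply/eqP.
  by move: a1 => /card_le1_eqP; apply.
have in_le : \sum_(z : Y) #|Y| ^ (#|A| - 2) = #|Y| ^ #|A|.-1.
  by rewrite sum_nat_const_pred -expnS; congr (_ ^ _); lia.
rewrite in_le sum_nat_const_pred leq_mul //.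
by rewrite (leq_trans (max_card _)) // card_prod mulnn.
Qed.

End Counting.

(** * Copies of a graph as edge sets *)

Section Copies.
Local Open Scope nat_scope.
Variables (A Y : finType) (EA : {set {set A}}).
Implicit Types (f : {ffun A -> Y}) (J : {set {set A}}) (X : {set {set Y}}).

Definition ime f J : {set {set Y}} := [set f @: (e : {set A}) | e in J].

Lemma ime_inj f : injective f -> injective (fun e : {set A} => f @: e).
Proof. by move=> fi; apply: imset_inj. Qed.

Lemma card_ime f J : injective f -> #|ime f J| = #|J|.
Proof. by move=> fi; rewrite card_imset //; apply: ime_inj. Qed.

Lemma cover_ime f J : cover (ime f J) = f @: cover J.
Proof.
apply/setP => y; apply/bigcupP/imsetP => [[_ /imsetP[e eJ ->] /imsetP[x xe ->]]|].
  by exists x => //; apply/bigcupP; exists e.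
by move=> [x /bigcupP[e eJ xe] ->]; exists (f @: e); rewrite imset_f.
Qed.

Lemma ime_sub f J X : (ime f J \subset X) = [forall e in J, f @: e \in X].
Proof.
apply/subsetP/forall_inP => [JX e eJ|JX _ /imsetP[e eJ ->]]; last exact: JX.
by apply: JX; apply: imset_f.
Qed.

Lemma preim_ime f X : injective f -> X \subset ime f EA ->
  exists J, [/\ J \subset EA, ime f J = X & #|J| = #|X|].
Proof.
move=> fi XEA; exists [set e in EA | f @: e \in X].
have eq : ime f [set e in EA | f @: e \in X] = X.
  apply/setP => u; apply/imsetP/idP => [[e]|uX].
    by rewrite inE => /andP[_ eX] ->.
  have /imsetP[e eEA ue] := subsetP XEA u uX.
  by exists e => //; rewrite inE eEA -ue.
split=> //; last by rewrite -[in RHS]eq card_ime.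
by apply/subsetP => e; rewrite inE => /andP[].
Qed.

(** Such maps send the vertices of J into those of X, which are equally many, and are free
    elsewhere: only the vertices outside [cover J] contribute powers of [#|Y|]. *)
Lemma card_copies_eq J X : #|[pred f : {ffun A -> Y} | injectiveb f && (ime f J == X)]| <=
  #|A| ^ #|A| * #|Y| ^ (#|A| - #|cover J|).
Proof.
have [f0 /andP[/injectiveP f0i /eqP f0X]|no] :=
    pickP [pred f : {ffun A -> Y} | injectiveb f && (ime f J == X)]; last first.
  by rewrite (eq_card no) card0.
apply: (leq_trans (@card_ffun_into _ _ _ (cover J) (cover X) _)).
  by move=> f /andP[_ /eqP<-] x xJ; rewrite cover_ime imset_f.
rewrite leq_mul // -f0X cover_ime card_imset //.
exact/leq_self_exp/max_card.
Qed.

(** This bounds the degree of X in the hypergraph of copies: sort the maps by the set J of edges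
    that is sent onto X. *)
Lemma card_copies_containing X :
  #|[pred f : {ffun A -> Y} | injectiveb f && (X \subset ime f EA)]| <=
  \sum_(J : {set {set A}} | (J \subset EA) && (#|J| == #|X|))
     #|A| ^ #|A| * #|Y| ^ (#|A| - #|cover J|).
Proof.
apply: (@leq_trans (\sum_(J : {set {set A}} | (J \subset EA) && (#|J| == #|X|))
  #|[pred f : {ffun A -> Y} | injectiveb f && (ime f J == X)]|)).
  apply: card_union_bound => f /andP[fi /(preim_ime (injectiveP _ fi))[J [JE JX cJ]]].
  by exists J; rewrite /= ?JE ?cJ ?eqxx // fi JX eqxx.
apply: leq_sum => J /andP[JE _].
exact: card_copies_eq.
Qed.

(** Edge sets rather than maps: two maps differing by an automorphism give the same event, and must
    not count as a clashing pair in Janson's inequality. *)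
Definition copies : {set {set {set Y}}} :=
  [set ime f EA | f in [pred f : {ffun A -> Y} | injectiveb f]].

Lemma copiesP C : reflect (exists2 f : {ffun A -> Y}, injective f & C = ime f EA)
  (C \in copies).
Proof.
by apply: (iffP imsetP) => -[f fi ->]; exists f => //; apply/injectiveP.
Qed.

Lemma card_copies_in X : cover EA = setT ->
  #|[pred f : {ffun A -> Y} | injectiveb f && (ime f EA \subset X)]| <=
  #|A| ^ #|A| * #|[set C in copies | C \subset X]|.
Proof.
move=> EAT; rewrite mulnC -sum_nat_const.
apply: (@leq_trans (\sum_(C in [set C in copies | C \subset X])
  #|[pred f : {ffun A -> Y} | injectiveb f && (ime f EA == C)]|)).
  apply: card_union_bound => f /andP[fi fX]; exists (ime f EA).
    by rewrite !inE fX andbT; apply/copiesP; exists f => //; apply/injectiveP.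
  by rewrite /= fi eqxx.
apply: leq_sum => C _; apply: leq_trans (card_copies_eq _ _) _.
by rewrite EAT cardsT subnn muln1.
Qed.

End Copies.

Section Supersaturation.
Local Open Scope nat_scope.
Variables (A B Y : finType) (EA : {set {set A}}) (EB : {set {set B}}).
Hypothesis EA2 : forall e, e \in EA -> #|e| = 2.
Hypothesis EB2 : forall e, e \in EB -> #|e| = 2.
Let r := 2 ^ (#|A| + #|B|).

(** Ramsey's theorem averaged over all maps g from r points to Y: an injective g pulls the colouring
    back to a complete graph containing one of the two copies. A given copy in Y is met by g in at
    most r^|A| (or r^|B|) positions, and g is then free on the remaining points. *)
Lemma supersaturation (X : {set {set Y}}) :
  #|Y| ^ r <= r ^ 2 * #|Y| ^ r.-1 +
    r ^ #|A| * #|[pred f : {ffun A -> Y} | injectiveb f && (ime f EA \subset X)]|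
      * #|Y| ^ (r - #|A|) +
    r ^ #|B| * #|[pred f : {ffun B -> Y} | injectiveb f && (ime f EB \subset ~: X)]|
      * #|Y| ^ (r - #|B|).
Proof.
pose P (D : finType) (ED : {set {set D}}) (Z : {set {set Y}}) :=
  [pred g : {ffun 'I_r -> Y} | [exists phi : {ffun D -> 'I_r}, exists f : {ffun D -> Y},
    [&& injectiveb phi, injectiveb f, ime f ED \subset Z & [forall x, g (phi x) == f x]]]].
have PD (D : finType) (ED : {set {set D}}) (Z : {set {set Y}}) : #|P D ED Z| <=
    r ^ #|D| * #|[pred f : {ffun D -> Y} | injectiveb f && (ime f ED \subset Z)]|
      * #|Y| ^ (r - #|D|).
  apply: (@leq_trans (\sum_(phi : {ffun D -> 'I_r} | injectiveb phi)
     \sum_(f : {ffun D -> Y} | injectiveb f && (ime f ED \subset Z))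
       #|[pred g : {ffun 'I_r -> Y} | [forall x, g (phi x) == f x]]|)).
    rewrite pair_big /=; apply: card_union_bound => g /existsP[phi /existsP[f]].
    by case/and4P => phi_i fi fZ gf; exists (phi, f); rewrite //= phi_i fi.
  apply: (@leq_trans (\sum_(phi : {ffun D -> 'I_r} | injectiveb phi)
     \sum_(f : {ffun D -> Y} | injectiveb f && (ime f ED \subset Z)) #|Y| ^ (r - #|D|))).
    apply: leq_sum => phi /injectiveP phi_i; apply: leq_sum => f _.
    by have := card_ffun_extending f phi_i; rewrite card_ord.
  rewrite sum_nat_const_pred sum_nat_const_pred mulnA leq_mul // leq_mul //.
  by apply: leq_trans (max_card _) _; rewrite card_ffun card_ord.
have -> : #|Y| ^ r = #|predT : pred {ffun 'I_r -> Y}| by rewrite card_ffun card_ord.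
have NI := card_ffun_noninj 'I_r Y; rewrite card_ord in NI.
apply: leq_trans (leq_add (leq_add NI (PD A EA X)) (PD B EB (~: X))).
have cardU (Q Q' : pred {ffun 'I_r -> Y}) : #|[predU Q & Q']| <= #|Q| + #|Q'|.
  by rewrite -cardUI leq_addr.
apply: leq_trans (leq_add (cardU _ _) (leqnn _)).
apply: leq_trans (cardU _ _); apply: subset_leq_card; apply/subsetP => g _.
rewrite !inE; have [/injectiveP g_inj|//] := boolP (injectiveb g).
have PI (D : finType) (ED : {set {set D}}) (Z : {set {set Y}}) (f : {ffun D -> 'I_r}) :
    injective f -> (forall e, e \in ED -> g @: (f @: e) \in Z) -> P D ED Z g.
  move=> fi fZ; apply/existsP; exists f; apply/existsP; exists [ffun x => g (f x)].
  apply/and4P; split; first exact/injectiveP.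
  - by apply/injectiveP => x y; rewrite !ffunE => /g_inj/fi.
  - rewrite ime_sub; apply/forall_inP => e /fZ.
    suff -> : [ffun x => g (f x)] @: e = g @: (f @: e) by [].
    by rewrite -imset_comp; apply: eq_imset => x; rewrite ffunE.
  - by apply/forallP => x; rewrite ffunE.
have [[f fi fX]|[f fi fX]] := ramsey EA2 EB2 (fun e => g @: e \in X).
  by move: (PI A EA X f fi fX); rewrite /P /= => ->.
have fX' e : e \in EB -> g @: (f @: e) \in ~: X by move=> /fX; rewrite inE.
by move: (PI B EB (~: X) f fi fX'); rewrite /P /= => ->; rewrite orbT.
Qed.

End Supersaturation.

Section CopiesReal.
Local Open Scope ring_scope.
Variables (R : realFieldType) (A Y : finType) (EA : {set {set A}}).
Local Notation copies := (@copies A Y EA).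
Local Notation n := (#|Y|%:R : R).

Lemma sum_copies_le (F : {set {set Y}} -> R) (P : pred {set {set Y}}) : (forall C, 0 <= F C) ->
  \sum_(C in copies | P C) F C <=
  \sum_(f : {ffun A -> Y} | injectiveb f && P (ime f EA)) F (ime f EA).
Proof.
move=> F0; rewrite [leRHS](eq_bigl (fun f =>
   (f \in [pred f : {ffun A -> Y} | injectiveb f && P (ime f EA)]))) //.
rewrite (partition_big_imset (fun f : {ffun A -> Y} => ime f EA)) /=.
rewrite (eq_bigl (fun C => C \in [set ime f EA | f in
   [pred f : {ffun A -> Y} | injectiveb f && P (ime f EA)]])); last first.
  move=> C; apply/andP/imsetP => [[/copiesP[f fi ->] PC]|[f]].
    by exists f => //; rewrite inE PC andbT; apply/injectiveP.
  by rewrite inE => /andP[/injectiveP fi PC ->]; split=> //; apply/copiesP; exists f.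
apply: ler_sum => _ /imsetP[f fP ->].
rewrite (bigD1 f) /=; last by rewrite -topredE /= in fP *; rewrite fP eqxx.
by rewrite lerDl; apply: sumr_ge0.
Qed.

(* Classify the copies D by the proper part J of the graph that they share
   with C. *)
Lemma clash_sum (p tau : R) : 0 <= p -> 0 <= tau -> (0 < #|A|)%N ->
  (forall J : {set {set A}}, J \subset EA -> J != set0 -> J != EA ->
     n ^+ (#|A| - #|cover J|) * p ^+ (#|EA| - #|J|) <= tau) ->
  \sum_(C in copies) \sum_(D in copies | (D != C) && clash C D) p ^+ #|C :|: D| <=
  (2 ^ #|EA| * #|A| ^ #|A|)%N%:R * tau * (n ^+ #|A| * p ^+ #|EA|).
Proof.
move=> p0 tau0 A0 Htau.
pose K : R := (#|A| ^ #|A|)%N%:R.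
pose G : R := 2 ^+ #|EA| * (K * (tau * p ^+ #|EA|)).
have inner (f : {ffun A -> Y}) : injective f ->
    \sum_(D in copies | (D != ime f EA) && clash (ime f EA) D) p ^+ #|ime f EA :|: D| <= G.
  move=> fi; apply: (le_trans (sum_copies_le _ _)); first by move=> D; apply: exprn_ge0.
  pose J (g : {ffun A -> Y}) := [set e in EA | g @: e \in ime f EA].
  pose Q (K : {set {set A}}) := [&& K \subset EA, K != set0 & K != EA].
  have JQ (g : {ffun A -> Y}) : injectiveb g && ((ime g EA != ime f EA) && clash (ime f EA) (ime g EA)) -> Q (J g).
    move=> /and3P[/injectiveP gi gf cl]; apply/and3P; split.
    - by apply/subsetP => e; rewrite inE => /andP[].
    - apply: contraNneq cl => J0; rewrite disjoint_sym disjoints_subset.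
      apply/subsetP => _ /imsetP[e eEA ->]; rewrite inE; apply/negP => gf'.
      have : e \in J g by rewrite inE eEA.
      by rewrite J0 inE.
    - apply: contraNneq gf => JE; rewrite eqEcard !card_ime // leqnn andbT ime_sub.
      by apply/forall_inP => e; rewrite -{1}JE inE => /andP[].
  rewrite (partition_big J Q) //=.
  apply: (@le_trans _ _ (\sum_(L : {set {set A}} | Q L) K * (tau * p ^+ #|EA|))).
    apply: ler_sum => L /and3P[LE L0 LN].
    apply: (@le_trans _ _ (\sum_(g in [pred g : {ffun A -> Y} | injectiveb g && (J g == L)])
        p ^+ (#|EA| - #|L| + #|EA|))).
      rewrite big_mkcond [leRHS]big_mkcond; apply: ler_sum => g _; rewrite inE.
      case: (boolP (injectiveb g)) => /= [/injectiveP gi|_]; last exact: lexx.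
      case: (eqVneq (J g) L) => [JL|_]; last by rewrite andbF.
      rewrite andbT; case: ifP => _; last exact: exprn_ge0.
      suff -> : #|ime f EA :|: ime g EA| = (#|EA| - #|L| + #|EA|)%N by [].
      rewrite cardsU !card_ime //.
      have -> : ime f EA :&: ime g EA = ime g L.
        apply/setP => u; rewrite inE; apply/andP/imsetP => [[uf /imsetP[e eEA ug]]|[e]].
          by exists e => //; rewrite -JL inE eEA -ug.
        by rewrite -JL inE => /andP[eEA gef] ->; split=> //; apply: imset_f.
      rewrite card_ime //; have := subset_leq_card LE; lia.
    rewrite sumr_const -[leLHS]mulr_natl exprD.
    (* The vertices of the shared part L must go to vertices of the fixed copy, a bounded number of
       choices; only the others range over Y. *)
    have cardJ : (#|[pred g : {ffun A -> Y} | injectiveb g && (J g == L)]| <=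
        #|A| ^ #|A| * #|Y| ^ (#|A| - #|cover L|))%N.
      apply: (leq_trans (@card_ffun_into _ _ _ (cover L) (cover (ime f EA)) _)).
        move=> g /andP[_ /eqP JL] x /bigcupP[e eL xe].
        by apply/bigcupP; exists (g @: e); [move: eL; rewrite -JL inE => /andP[]|apply: imset_f].
      rewrite leq_mul // cover_ime card_imset //.
      apply: leq_trans (_ : #|A| ^ #|cover L| <= _)%N; last by rewrite leq_pexp2l ?max_card.
      by have [->|c0] := posnP #|cover L|; rewrite ?expn0 // leq_exp2r // max_card.
    apply: (@le_trans _ _ ((#|A| ^ #|A| * #|Y| ^ (#|A| - #|cover L|))%N%:R *
       (p ^+ (#|EA| - #|L|) * p ^+ #|EA|))).
      by rewrite ler_wpM2r ?mulr_ge0 ?exprn_ge0 // ler_nat.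
    rewrite natrM -/K natrX -!mulrA ler_wpM2l ?ler0n // mulrA ler_wpM2r ?exprn_ge0 //.
    exact: Htau.
  have KT0 : 0 <= K * (tau * p ^+ #|EA|) by rewrite !mulr_ge0 ?ler0n ?exprn_ge0.
  rewrite sumr_const -[leLHS]mulr_natl /G ler_wpM2r // -natrX ler_nat.
  rewrite -card_powerset; apply: subset_leq_card; apply/subsetP => L /and3P[LE _ _].
  by rewrite inE.
have G0 : 0 <= G by rewrite !mulr_ge0 ?ler0n ?exprn_ge0.
apply: (@le_trans _ _ (\sum_(C in copies) G)).
  by apply: ler_sum => _ /copiesP[f fi ->]; apply: inner.
rewrite sumr_const -[leLHS]mulr_natl.
apply: (@le_trans _ _ (n ^+ #|A| * G)).
  rewrite ler_wpM2r // -natrX ler_nat -card_ffun.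
  exact: leq_trans (leq_imset_card _ _) (max_card _).
rewrite natrM -/K natrX /G; clear.
move: K (2 ^+ _) (p ^+ _) (n ^+ _) => k u v y.
by rewrite le_eqVlt; apply/orP; left; apply/eqP; ring.
Qed.
End CopiesReal.

(** * The union bound *)

Section SmallSubsets.
Variables (R : realType) (T : finType).

Lemma sum_powerset (U : {set T}) (x : R) :
  \sum_(S : {set T} | S \subset U) x ^+ #|S| = (1 + x) ^+ #|U|.
Proof.
transitivity (\prod_(i : T) ((if i \in U then x else 0) + 1)).
  rewrite bigA_distr /= big_mkcond; apply: eq_bigr => S _; case: ifPn => SU.
    rewrite -prodr_const big_mkcond; apply: eq_bigr => i _.
    by case: ifP => // /(subsetP SU) ->.
  have [i iS iU] := subsetPn SU.
  by rewrite (bigD1 i) //= iS (negbTE iU) mul0r.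
rewrite -prodr_const [RHS]big_mkcond; apply: eq_bigr => i _.
by case: ifP => _; rewrite addrC ?addr0.
Qed.

(* x ^ #|S| <= M ^ b * (x / M) ^ #|S|, and the sum over all S is explicit. *)
Lemma small_subsets (U : {set T}) (x M b : R) : 0 <= x -> 1 <= M ->
  \sum_(S : {set T} | (S \subset U) && (#|S|%:R <= b)%R) x ^+ #|S| <=
  expR (b * ln M + #|U|%:R * (x / M)).
Proof.
move=> x0 M1; have M0 : 0 < M by apply: lt_le_trans M1.
rewrite expRD; apply: (@le_trans _ _ (\sum_(S : {set T} | S \subset U)
   expR (b * ln M) * (x / M) ^+ #|S|)).
  rewrite [leRHS](bigID (fun S : {set T} => (#|S|%:R <= b)%R)) /= -[leLHS]addr0 lerD //.
    apply: ler_sum => S /andP[_ Sb].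
    rewrite -{1}[x](divfK (lt0r_neq0 M0)) exprMn mulrC ler_wpM2r //.
      by rewrite exprn_ge0 // divr_ge0 // ltW.
    rewrite -[M in leLHS](@lnK R) ?posrE // -expRM_natl ler_expR ler_wpM2r //.
    exact: ln_ge0.
  by apply: sumr_ge0 => S _; rewrite mulr_ge0 ?expR_ge0 // exprn_ge0 // divr_ge0 // ltW.
rewrite -mulr_sumr sum_powerset ler_wpM2l ?expR_ge0 // expRM_natl.
have y0 : 0 <= x / M by rewrite divr_ge0 // ltW.
rewrite lerXn2r ?expR_ge1Dx // nnegrE ?expR_ge0 //; lra.
Qed.

End SmallSubsets.

(** * The arrow relation on edge sets and minimal red sets *)

Section Arrow.
Variables (A B Y : finType) (EA : {set {set A}}) (EB : {set {set B}}).

Definition has_copy (D : finType) (ED : {set {set D}}) (X : {set {set Y}}) : bool :=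
  [exists f : {ffun D -> Y}, injectiveb f && (ime f ED \subset X)].

Lemma has_copyP (D : finType) (ED : {set {set D}}) (X : {set {set Y}}) :
  reflect (exists2 C, C \in copies Y ED & C \subset X) (has_copy ED X).
Proof.
apply: (iffP existsP) => [[f /andP[/injectiveP fi fX]]|[_ /copiesP[f fi ->] fX]].
  by exists (ime f ED) => //; apply/copiesP; exists f.
by exists f; rewrite fX andbT; apply/injectiveP.
Qed.

Lemma has_copyS (D : finType) (ED : {set {set D}}) (X X' : {set {set Y}}) :
  X \subset X' -> has_copy ED X -> has_copy ED X'.
Proof.
by move=> XX' /has_copyP[C CD CX]; apply/has_copyP; exists C => //; apply: subset_trans XX'.
Qed.

Definition arrow (X : {set {set Y}}) : bool :=
  [forall Q : {set {set Y}}, has_copy EA (X :&: Q) || has_copy EB (X :\: Q)].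

Lemma arrowS (X X' : {set {set Y}}) : X \subset X' -> arrow X -> arrow X'.
Proof.
move=> XX' /forallP aX; apply/forallP => Q; case/orP: (aX Q) => h; apply/orP.
  by left; apply: has_copyS h; apply: setSI.
by right; apply: has_copyS h; apply: setSD.
Qed.

Lemma minimal_red X : ~~ arrow X -> exists Q : {set {set Y}},
  [/\ Q \subset X, ~~ has_copy EA Q, ~~ has_copy EB (X :\: Q) &
   forall e, e \in Q -> exists C, [/\ C \in copies Y EB, C \subset X & C :&: Q = [set e]]].
Proof.
move=> /forallPn[Q0]; rewrite negb_or => /andP[Ared Bblue].
pose P (Q : {set {set Y}}) := ~~ has_copy EB (X :\: Q).
have PX : P (X :&: Q0).
  apply: contra Bblue; apply: has_copyS; rewrite setDIr setDv set0U //.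
(* Minimizing below the given red class creates no red copy, while turning any e of Q blue must
   create a blue one. *)
have [Q /minsetP[PQ Qmin] QX] := minset_exists PX.
have QX' : Q \subset X by apply: subset_trans QX (subsetIl _ _).
exists Q; split=> //; first by apply: contra Ared; apply: has_copyS.
move=> e eQ; have : has_copy EB (X :\: (Q :\ e)).
  case: (boolP (has_copy EB (X :\: (Q :\ e)))) => // Pe.
  have := Qmin (Q :\ e) Pe (subsetDl _ _).
  by move=> /setP/(_ e); rewrite !inE eqxx eQ.
move=> /has_copyP[C CB CX]; exists C; split=> //.
  by apply: subset_trans CX (subsetDl _ _).
have CQ : C :&: Q \subset [set e].
  apply/subsetP => u /setIP[uC uQ]; have := subsetP CX u uC.
  by rewrite !inE uQ andbT negbK => /andP[].
apply/eqP; rewrite eqEsubset CQ sub1set inE eQ andbT /=.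
apply/negPn/negP => eC; case/negP: PQ; apply/has_copyP; exists C => //.
apply/subsetP => u uC; have := subsetP CX u uC; rewrite !inE => /andP[uQe ->].
rewrite andbT; apply: contra uQe => ->; rewrite andbT.
by apply: contraNneq eC => <-.
Qed.

End Arrow.

Section UnionBound.
Variables (R : realType) (A B Y : finType) (EA : {set {set A}}) (EB : {set {set B}}).
Hypothesis EB2 : forall e, e \in EB -> #|e| = 2%N.
Local Notation copies := (copies Y EB).
Variable p : R.
Hypothesis p01 : 0 <= p <= 1.

Definition pairs : {set {set Y}} := [set e : {set Y} | #|e| == 2%N].
(* Giving probability 0 to the sets that are not edges puts G_{n,p} in the
   setting of a random subset of the whole type {set Y}. *)
Definition edge_prob (e : {set Y}) : R := if e \in pairs then p else 0.

Lemma edge_prob01 e : 0 <= edge_prob e <= 1.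
Proof. by rewrite /edge_prob; case: ifP; rewrite ?lexx ?ler01. Qed.

Lemma copy_pairs C : C \in copies -> C \subset pairs.
Proof.
move=> /copiesP[f fi ->]; rewrite ime_sub; apply/forall_inP => e /EB2 e2.
by rewrite inE card_imset // e2.
Qed.

Lemma card_copy C : C \in copies -> #|C| = #|EB|.
Proof. by move=> /copiesP[f fi ->]; rewrite card_ime. Qed.

Lemma prodset_pairs (S : {set {set Y}}) : S \subset pairs -> prodset edge_prob S = p ^+ #|S|.
Proof.
move=> SP; rewrite /prodset -prodr_const; apply: eq_bigr => e eS.
by rewrite /edge_prob (subsetP SP).
Qed.

Definition clash_count (X : {set {set Y}}) : R :=
  \sum_(C in copies) \sum_(D in copies | (D != C) && clash C D) (C :|: D \subset X)%:R.

(** The chosen copy [c e] meets S in e alone, so c is injective. S2 collects the edges whose copy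
    clashes with another chosen one: each gives its own clashing pair inside X, and the copies of
    all other edges are pairwise disjoint. *)
Lemma red_decomposition (X S : {set {set Y}}) :
  (forall e, e \in S -> exists C, [/\ C \in copies, C \subset X & C :&: S = [set e]]) ->
  exists (K : {set {set {set Y}}}) (S1 S2 : {set {set Y}}), [/\ S = S1 :|: S2, K \subset copies, trivIset K, (#|K| <= #|S|)%N &
    [/\ S1 \subset cover K, cover K \subset X & #|S2|%:R <= clash_count X]].
Proof.
move=> SC.
pose c e := odflt set0 [pick C in copies | (C \subset X) && (C :&: S == [set e])].
have cP e : e \in S -> [/\ c e \in copies, c e \subset X & c e :&: S = [set e]].
  move=> /SC[C [CB CX /eqP CS]]; rewrite /c; case: pickP => [D /and3P[? ? /eqP]//|/(_ C)].
  by rewrite CB CX CS.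
have ce e : e \in S -> e \in c e.
  by move=> /cP[_ _ /setP/(_ e)]; rewrite !inE eqxx => /andP[].
have c_inj : {in S &, injective c}.
  move=> e e' /cP[_ _ h] /cP[_ _ h'] ee'; apply/set1P.
  by rewrite -h' -ee' h set11.
pose S2 := [set e in S | [exists e' in S, (e' != e) && clash (c e) (c e')]].
have S2S : S2 \subset S by apply/subsetP => e; rewrite inE => /andP[].
exists (c @: (S :\: S2)), (S :\: S2), S2; split.
- by rewrite -[LHS](setID S S2) (setIidPr S2S) setUC.
- by apply/subsetP => _ /imsetP[e /setDP[/cP[? _ _] _] ->].
- apply/trivIsetP => _ _ /imsetP[e /setDP[eS eS2] ->] /imsetP[e' /setDP[eS' _] ->] ee'.
  apply/negPn/negP => cl; case/negP: eS2; rewrite inE eS; apply/exists_inP.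
  by exists e' => //; rewrite /clash cl andbT; apply: contraNneq ee' => ->.
- by apply: leq_trans (leq_imset_card _ _) _; rewrite subset_leq_card ?subsetDl.
split.
- apply/subsetP => e eS; apply/bigcupP; exists (c e); first exact: imset_f.
  by apply: ce; case/setDP: eS.
- by apply/bigcupsP => _ /imsetP[e /setDP[/cP[_ ? _] _] ->].
rewrite /clash_count -sum1_card natr_sum.
have -> : \sum_(e in S2) 1%:R = \sum_(C in c @: S2) 1 :> R.
  rewrite big_imset // => e e'; rewrite !inE => /andP[eS _] /andP[eS' _]; exact: c_inj.
rewrite big_mkcond [leRHS]big_mkcond; apply: ler_sum => C _.
have ge0 D : 0 <= (C :|: D \subset X)%:R :> R by rewrite ler0n.
case: (boolP (C \in c @: S2)) => [/imsetP[e]|_]; last by case: ifP => // _; apply: sumr_ge0.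
rewrite inE => /andP[eS /exists_inP[e' eS' /andP[ee' cl]]] ->.
have [cB cX _] := cP e eS; have [cB' cX' _] := cP e' eS'.
rewrite cB (bigD1 (c e')) /=; last first.
  by rewrite cB' cl andbT; apply: contraNneq ee' => /c_inj ->.
rewrite subUset cX cX' lerDl; apply: sumr_ge0 => D _; exact: ler0n.
Qed.

Lemma Ex_clash_count : Ex edge_prob clash_count =
  \sum_(C in copies) \sum_(D in copies | (D != C) && clash C D) p ^+ #|C :|: D|.
Proof.
rewrite /clash_count Ex_sum; apply: eq_bigr => C CB.
rewrite Ex_sum; apply: eq_bigr => D /andP[DB _]; rewrite Ex_containE prodset_pairs //.
by rewrite subUset !copy_pairs.
Qed.

Definition avoiding (S : {set {set Y}}) : seq {set {set Y}} :=
  enum [set C in copies | C \subset ~: S].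

(* K is a family of pairwise disjoint copies in the random set, covering the
   part S1 of the fingerprint; S2 is the part whose copies clash. *)
Lemma union_bound (f : {set {set Y}} -> {set {set Y}}) (good : pred {set {set Y}})
    (s : nat) (b J : R) :
  0 < b -> 0 <= J ->
  (forall Q : {set {set Y}}, ~~ has_copy EA Q -> exists S : {set {set Y}},
     [/\ S \subset Q, good S, (#|S| <= s)%N & Q :&: pairs \subset S :|: f S]) ->
  (forall S : {set {set Y}}, good S -> Ex edge_prob (fun X => (none (avoiding (S :|: f S)) X)%:R) <= J) ->
  Ex edge_prob (fun X => (~~ arrow EA EB X)%:R) <=
  Ex edge_prob clash_count / b +
  (\sum_(K : {set {set {set Y}}} | (K \subset copies) && (#|K|%:R <= s%:R :> R)%R)
      (2 ^+ #|EB| * p ^+ #|EB|) ^+ #|K|) *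
  (\sum_(S : {set {set Y}} | (S \subset pairs) && (#|S|%:R <= b)%R) 1 ^+ #|S|) * J.
Proof.
move=> b0 J0 Hf HJ; have [p0 p1] := andP p01.
pose PK (K : {set {set {set Y}}}) := [&& K \subset copies, trivIset K & (#|K|%:R <= s%:R :> R)%R].
pose PS (S : {set {set Y}}) := (S \subset pairs) && (#|S|%:R <= b)%R.
(* An increasing event times a decreasing one: [Ex_contain] splits off the probability of [cover K]
   and leaves the decreasing event to Janson's inequality. *)
pose term (K : {set {set {set Y}}}) (S1 S2 X : {set {set Y}}) : R := if good (S1 :|: S2) then
  (cover K \subset X)%:R * (none (avoiding ((S1 :|: S2) :|: f (S1 :|: S2))) X)%:R else 0.
have term0 K S1 S2 X : 0 <= term K S1 S2 X.
  by rewrite /term; case: ifP => // _; rewrite mulr_ge0 ?ler0n.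
have point X : (~~ arrow EA EB X)%:R <= (b < clash_count X)%R%:R +
    \sum_(K | PK K) \sum_(S1 : {set {set Y}} | S1 \subset cover K) \sum_(S2 | PS S2) term K S1 S2 X.
  have sum0 : 0 <= \sum_(K | PK K) \sum_(S1 : {set {set Y}} | S1 \subset cover K)
      \sum_(S2 | PS S2) term K S1 S2 X.
    by do 3 (apply: sumr_ge0 => ? _).
  case: (boolP (arrow EA EB X)) => [_|/minimal_red[Q [QX Qred Qblue Qe]]].
    by rewrite addr_ge0 ?ler0n.
  case: ltP => [_|Xb]; first by rewrite lerDl.
  rewrite add0r; have [S [SQ gS Ss QS]] := Hf Q Qred.
  have [K [S1 [S2 [SS KB Kt KS [S1K KX S2b]]]]] : exists (K : {set {set {set Y}}}) (S1 S2 : {set {set Y}}),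
      [/\ S = S1 :|: S2, K \subset copies, trivIset K, (#|K| <= #|S|)%N &
      [/\ S1 \subset cover K, cover K \subset X & #|S2|%:R <= clash_count X]].
    apply: red_decomposition => e eS; have [C [CB CX CQ]] := Qe e (subsetP SQ e eS).
    by exists C; split=> //; rewrite -(setIidPr SQ) setIA CQ (setIidPl _) // sub1set.
  have SP : S \subset pairs.
    apply/subsetP => e eS; have [C [CB _ /setP/(_ e)]] := Qe e (subsetP SQ e eS).
    by rewrite !inE eqxx => /andP[eC _]; have := subsetP (copy_pairs CB) e eC; rewrite inE.
  (* All of Q among the pairs lies in [S :|: f S], so a copy in X avoiding that set would avoid Q
     and be blue. *)
  have -> : 1%:R = term K S1 S2 X.
    rewrite /term -SS gS KX mul1r; congr (_%:R); apply/esym/eqP; rewrite eqb1.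
    apply/allP => C; rewrite mem_enum inE => /andP[CB CS]; apply: contra Qblue => CX.
    apply/has_copyP; exists C => //; apply/subsetP => e eC.
    rewrite inE (subsetP CX) // andbT; apply/negP => eQ.
    have := subsetP CS e eC; rewrite inE (subsetP QS) //.
    by rewrite inE eQ (subsetP (copy_pairs CB)).
  rewrite (bigD1 K) /=; last by rewrite /PK KB Kt ler_nat (leq_trans KS).
  apply: ler_wpDr; first by do 3 (apply: sumr_ge0 => ? _).
  rewrite (bigD1 S1) //=; apply: ler_wpDr; first by do 2 (apply: sumr_ge0 => ? _).
  rewrite (bigD1 S2) /=; first by rewrite lerDl; apply: sumr_ge0.
  rewrite /PS (le_trans S2b) // andbT; apply: subset_trans SP.
  by rewrite SS subsetUr.
apply: (le_trans (le_Ex edge_prob01 point)); rewrite ExD.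
have cc0 X : 0 <= clash_count X by do 2 (apply: sumr_ge0 => ? _); apply: ler0n.
apply: lerD; first exact: (markov_Ex edge_prob01 cc0 b0).
rewrite Ex_sum -mulrA [X in _ <= _ * X]mulr_suml mulr_suml.
(* The factor [2 ^+ #|EB|] per copy counts the sets S1 inside [cover K]; the powers of 1 count the
   sets S2 in the form that [small_subsets] bounds. *)
apply: (@le_trans _ _ (\sum_(K | PK K) (2 ^+ #|EB| * p ^+ #|EB|) ^+ #|K| *
   (\sum_(S | PS S) 1 ^+ #|S| * J))); last first.
  rewrite [X in _ <= X](bigID (fun K => trivIset K)) /= -[leLHS]addr0 lerD //.
    rewrite le_eqVlt; apply/orP; left; apply/eqP; apply: eq_bigl => K.
    by rewrite /PK andbAC andbA.
  apply: sumr_ge0 => K _; rewrite mulr_ge0 ?exprn_ge0 ?mulr_ge0 ?exprn_ge0 //.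
  by apply: sumr_ge0 => ? _; rewrite expr1n mul1r.
apply: ler_sum => K /and3P[KB /eqP Kt _]; rewrite Ex_sum.
have coverK : #|cover K| = (#|EB| * #|K|)%N.
  rewrite -Kt (eq_bigr (fun=> #|EB|)) ?sum_nat_const 1?mulnC // => C CK.
  by rewrite card_copy // (subsetP KB).
have coverP : cover K \subset pairs.
  by apply/bigcupsP => C CK; apply: copy_pairs; apply: (subsetP KB).
apply: (@le_trans _ _ (\sum_(S1 : {set {set Y}} | S1 \subset cover K)
    p ^+ #|cover K| * \sum_(S | PS S) 1 ^+ #|S| * J)); last first.
  rewrite sumr_const -[leLHS]mulr_natl mulrA ler_wpM2r //.
    by apply: sumr_ge0 => ? _; rewrite expr1n mul1r.
  have -> : #|fun S1 : {set {set Y}} => S1 \subset cover K| = #|powerset (cover K)|.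
    by apply: eq_card => S1; rewrite inE.
  by rewrite card_powerset coverK natrX -!exprMn exprM.
apply: ler_sum => S1 _; rewrite Ex_sum mulr_sumr; apply: ler_sum => S2 _.
rewrite expr1n mul1r /term; case: (boolP (good (S1 :|: S2))) => [gS|_]; last first.
  by rewrite Ex_cst mulr_ge0 // exprn_ge0.
rewrite Ex_contain prodset_pairs // ler_wpM2l ?exprn_ge0 //.
apply: le_trans (HJ _ gS); apply: le_Ex => [|X]; first exact: edge_prob01.
by apply: ler_bool; apply: none_anti; apply: subsetUr.
Qed.

End UnionBound.

(** * An explicit bound for a fixed number of vertices *)

Section FiniteBound.
Variables (R : realType) (A B Y : finType) (EA : {set {set A}}) (EB : {set {set B}}).
Hypothesis EA2 : forall e, e \in EA -> #|e| = 2%N.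
Hypothesis EB2 : forall e, e \in EB -> #|e| = 2%N.
Hypothesis EA_neq0 : EA != set0.
Hypothesis coverEB : cover EB = setT.
Hypothesis B_gt0 : (0 < #|B|)%N.
Local Notation n := (#|Y|%:R : R).
Local Notation copiesB := (copies Y EB).

(* Locked: arithmetic tactics must not evaluate the power. *)
Definition ramsey_bound : nat := locked (2 ^ (#|A| + #|B|))%N.
Local Notation r := (ramsey_bound%:R : R).
Definition degree_const : R := (2 ^ #|EA| * #|A| ^ #|A|)%N%:R.
Definition clash_const : R := (2 ^ #|EB| * #|B| ^ #|B|)%N%:R.
(* With fewer than n ^ #|A| / (4 r ^ #|A|) red copies, which is twice
   red_ratio * degree_const * n ^ #|A|, at most a quarter of all maps from 'I_r contain a
   red copy and at most a quarter are not injective, so half of them contain a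
   blue copy. *)
Definition red_ratio : R := 1 / (8 * r ^+ #|A| * degree_const).
Definition blue_ratio : R := 1 / (2 * r ^+ #|B| * (#|B| ^ #|B|)%N%:R).

Lemma ramsey_boundE : ramsey_bound = (2 ^ (#|A| + #|B|))%N.
Proof. by rewrite /ramsey_bound -lock. Qed.

Lemma ramsey_bound_gt0 : 0 < r.
Proof. by rewrite ltr0n ramsey_boundE expn_gt0. Qed.

Lemma self_exp_gt0 m : (0 < m ^ m)%N.
Proof. by case: m => // m; rewrite expn_gt0. Qed.

Lemma degree_const_gt0 : 0 < degree_const.
Proof. by rewrite ltr0n muln_gt0 expn_gt0 self_exp_gt0. Qed.

Lemma red_ratio_gt0 : 0 < red_ratio.
Proof. by rewrite divr_gt0 // !mulr_gt0 // ?exprn_gt0 ?ramsey_bound_gt0 ?degree_const_gt0. Qed.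

Lemma blue_ratio_gt0 : 0 < blue_ratio.
Proof. by rewrite divr_gt0 // !mulr_gt0 // ?exprn_gt0 ?ramsey_bound_gt0 ?ltr0n ?self_exp_gt0. Qed.

Lemma many_copies (X : {set {set Y}}) : 4 * r ^+ 2 <= n ->
  #|[pred f : {ffun A -> Y} | injectiveb f && (ime f EA \subset X)]|%:R <=
    n ^+ #|A| / (4 * r ^+ #|A|) ->
  blue_ratio * n ^+ #|B| <= #|[set C in copiesB | C \subset ~: X]|%:R.
Proof.
have rA : (#|A| <= ramsey_bound)%N.
  by rewrite ramsey_boundE; apply: leq_trans (ltnW (ltn_expl _ (ltnSn 1))); apply: leq_addr.
have rB : (#|B| <= ramsey_bound)%N.
  by rewrite ramsey_boundE; apply: leq_trans (ltnW (ltn_expl _ (ltnSn 1))); apply: leq_addl.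
have r_pos : (0 < ramsey_bound)%N by rewrite ramsey_boundE expn_gt0.
have r0 := ramsey_bound_gt0.
move=> nr Aup; have n0 : 0 < n by apply: lt_le_trans nr; rewrite mulr_gt0 ?exprn_gt0.
have := supersaturation EA2 EB2 X; rewrite -ramsey_boundE /blue_ratio.
move: ramsey_bound rA rB r_pos r0 nr Aup => rb rA rB r_pos r0 nr; rewrite -(ler_nat R).
set a := #|[pred f : {ffun A -> Y} | _]|; move: a => a Aup.
have := card_copies_in (~: X) coverEB; set b := #|[pred f : {ffun B -> Y} | _]|.
move: b => b; rewrite -(ler_nat R) natrM; set m := #|[set C in _ | _]|; move: m => m.
move: (#|B| ^ #|B|)%N (self_exp_gt0 #|B|) => c c0 bm.
rewrite !natrD !natrM !natrX => main.
have T1 : rb%:R ^+ 2 * n ^+ rb.-1 <= n ^+ rb / 4.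
  have -> : n ^+ rb = n * n ^+ rb.-1 by rewrite -exprS prednK.
  by rewrite ler_pdivlMr // mulrAC ler_wpM2r ?exprn_ge0 ?(ltW n0) // mulrC.
have T2 : rb%:R ^+ #|A| * a%:R * n ^+ (rb - #|A|) <= n ^+ rb / 4.
  have -> : n ^+ rb = n ^+ (rb - #|A|) * n ^+ #|A|.
    by rewrite -exprD subnK.
  rewrite ler_pdivlMr // mulrAC mulrC ler_wpM2l ?exprn_ge0 ?(ltW n0) //.
  by move: Aup; rewrite ler_pdivlMr ?mulr_gt0 ?exprn_gt0 //; lra.
have T3 : n ^+ #|B| / 2 <= rb%:R ^+ #|B| * b%:R.
  rewrite -(ler_pM2r (exprn_gt0 (rb - #|B|) n0)).
  rewrite mulrAC -exprD subnKC //; move: main T1 T2.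
  move: (rb%:R ^+ 2 * n ^+ rb.-1) (rb%:R ^+ #|A| * a%:R * n ^+ (rb - #|A|)).
  move: (rb%:R ^+ #|B| * b%:R * n ^+ (rb - #|B|)) (n ^+ rb) => x y z t.
  lra.
rewrite mulrAC mul1r ler_pdivrMr ?mulr_gt0 ?exprn_gt0 ?ltr0n //.
have : rb%:R ^+ #|B| * b%:R <= rb%:R ^+ #|B| * (c%:R * m%:R) :> R.
  by rewrite ler_wpM2l // exprn_ge0 // ltW.
move: T3; move: (rb%:R ^+ #|B|) (c%:R : R) => x y; rewrite (_ : m%:R * (2 * x * y) = 2 * (x * (y * m%:R))); last by ring.
lra.
Qed.

Section Probability.
Variables (p tau : R).
Hypothesis p01 : 0 <= p <= 1.
Hypothesis tau_ge0 : 0 <= tau.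
Hypothesis Htau : forall J : {set {set B}}, J \subset EB -> J != set0 -> J != EB ->
  n ^+ (#|B| - #|cover J|) * p ^+ (#|EB| - #|J|) <= tau.
Local Notation Q := (n ^+ #|B| * p ^+ #|EB|).
Local Notation prb := (@edge_prob R Y p).

Lemma Ex_clash_count_le : Ex prb (clash_count R EB) <= clash_const * tau * Q.
Proof.
by rewrite (Ex_clash_count Y EB2 p); apply: clash_sum => //; case/andP: p01.
Qed.

(** Restricting to copies that avoid X only decreases the clash sum, so the correction term is the
    same for all X. *)
Lemma janson_copies (X : {set {set Y}}) :
  Ex prb (fun Z => (none (avoiding EB X) Z)%:R) <=
  expR (- (#|[set C in copiesB | C \subset ~: X]|%:R * p ^+ #|EB|) + clash_const * tau * Q).
Proof.
have [p0 p1] := andP p01.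
apply: le_trans (janson (edge_prob01 p01) (enum_uniq _)) _; rewrite ler_expR.
rewrite !big_enum /=; apply: lerD.
  rewrite lerN2 mulr_natl -sumr_const; apply: ler_sum => C.
  by rewrite inE => /andP[CB _]; rewrite prodset_pairs ?(copy_pairs EB2) // (card_copy CB).
apply: le_trans (clash_sum p0 tau_ge0 B_gt0 Htau).
have ge0 C D : 0 <= p ^+ #|C :|: D| by move=> *; apply: exprn_ge0.
rewrite big_mkcond [leRHS]big_mkcond; apply: ler_sum => C _; rewrite inE.
case: (boolP (C \in copiesB)) => //= CB; case: ifP => _; last by apply: sumr_ge0 => *; apply: exprn_ge0.
rewrite big_enum_cond big_mkcond [leRHS]big_mkcond; apply: ler_sum => D _; rewrite inE.
case: (boolP (D \in copiesB)) => //= DB; case: (D \subset ~: X) => /=; last first.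
  by case: ifP => // _; apply: exprn_ge0.
by case: ifP => // _; rewrite prodset_pairs // subUset !(copy_pairs EB2).
Qed.

End Probability.

Section Fingerprints.
Variables (pA : R) (L k s : nat).
Hypothesis pA_gt0 : 0 < pA.
Hypothesis pA_le1 : pA <= 1.
Hypothesis HA : forall J : {set {set A}}, J \subset EA -> J != set0 ->
  1 <= n ^+ (#|cover J| - 2) * pA ^+ #|J|.-1.
Hypothesis nr : 4 * r ^+ 2 <= n.
Hypothesis pAL : n ^+ 2 * pA <= L%:R.
Hypothesis kgain : 1 <= k%:R * cont_gain #|EA|.-1 red_ratio.
Hypothesis s_def : s = (k * (#|EA|.-1 * L))%N.
Hypothesis s_le : s%:R <= red_ratio * n ^+ 2.

(** G may have isolated vertices, so that the number of maps with a given edge set can grow with n;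
    a weighted hypergraph absorbs this multiplicity. *)
Definition copy_weight (E : {set {set Y}}) : R :=
  #|[pred f : {ffun A -> Y} | injectiveb f && (ime f EA == E)]|%:R.

Lemma sum_copy_weight (P : pred {set {set Y}}) : \sum_(E | P E) copy_weight E =
  #|[pred f : {ffun A -> Y} | injectiveb f && P (ime f EA)]|%:R.
Proof.
rewrite -natr_sum; congr (_%:R).
rewrite -[RHS]sum1_card (partition_big (fun f : {ffun A -> Y} => ime f EA) P) /=; last first.
  by move=> f; rewrite inE => /andP[].
apply: eq_bigr => E PE; rewrite -sum1_card; apply: eq_bigl => f.
by rewrite !inE; case: eqP => [->|_]; rewrite ?PE ?andbT ?andbF.
Qed.

Lemma cards_cover_ge2 (J : {set {set A}}) : J \subset EA -> J != set0 -> (2 <= #|cover J|)%N.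
Proof.
move=> JE /set0Pn[e eJ]; rewrite -(EA2 (subsetP JE e eJ)); apply: subset_leq_card.
exact: bigcup_sup.
Qed.

Let D : R := degree_const * n ^+ (#|A| - 2).

(** If J is the part of G sent onto T, there are about n^(|A| - |cover J|) maps; by [HA] this is at
    most n^(|A| - 2) pA^(|J| - 1), the decay that the container theorem asks for. *)
Lemma wdeg_copy_weight (T : {set {set Y}}) : T != set0 ->
  wdeg copy_weight T <= D * pA ^+ #|T|.-1.
Proof.
move=> T0; rewrite /wdeg sum_copy_weight.
apply: (@le_trans _ _ (\sum_(J : {set {set A}} | (J \subset EA) && (#|J| == #|T|))
   (#|A| ^ #|A|)%N%:R * (n ^+ (#|A| - 2) * pA ^+ #|T|.-1))).
  have := card_copies_containing EA T; rewrite -(ler_nat R) natr_sum => /le_trans; apply.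
  apply: ler_sum => J /andP[JE /eqP JT]; rewrite natrM ler_wpM2l ?ler0n // natrX.
  have J0 : J != set0 by rewrite -card_gt0 JT card_gt0.
  have J2 := cards_cover_ge2 JE J0; have Jm : (#|cover J| <= #|A|)%N := max_card _.
  have -> : (#|A| - 2 = #|A| - #|cover J| + (#|cover J| - 2))%N by lia.
  rewrite exprD -mulrA -JT -[leLHS]mulr1 ler_wpM2l ?exprn_ge0 ?ler0n //; exact: HA.
rewrite sumr_const -[leLHS]mulr_natl /D /degree_const natrM -!mulrA ler_wpM2r //.
  by rewrite !mulr_ge0 ?exprn_ge0 ?ler0n // ltW.
rewrite ler_nat -card_powerset; apply: subset_leq_card; apply/subsetP => J /andP[JE _].
by rewrite inE.
Qed.

(** A copy of G inside [S :|: f S] lies in [f S] or uses an edge of S. The container theorem bounds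
    the first kind by [red_ratio * D * n ^+ 2], the degree bound the second by [s%:R * D], which is
    no larger by [s_le]. The sum is exactly what [many_copies] tolerates. *)
Lemma fingerprints : exists (f : {set {set Y}} -> {set {set Y}}),
  forall Q, ~~ has_copy EA Q -> exists S : {set {set Y}},
  [/\ S \subset Q, blue_ratio * n ^+ #|B| <= #|[set C in copiesB | C \subset ~: (S :|: f S)]|%:R,
      (#|S| <= s)%N & Q :&: pairs Y \subset S :|: f S].
Proof.
have r0 := ramsey_bound_gt0.
have n0 : 0 < n by apply: lt_le_trans nr; rewrite mulr_gt0 ?exprn_gt0.
have A2 : (2 <= #|A|)%N.
  exact: leq_trans (cards_cover_ge2 (subxx _) EA_neq0) (max_card _).
have D0 : 0 < D by rewrite mulr_gt0 ?degree_const_gt0 ?exprn_gt0.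
have DN : D * n ^+ 2 = degree_const * n ^+ #|A| by rewrite /D -mulrA -exprD subnK.
have w0 E : 0 <= copy_weight E by rewrite ler0n.
have wl E : copy_weight E != 0 -> #|E| = #|EA|.-1.+1.
  rewrite pnatr_eq0 -lt0n => /card_gt0P[f /andP[/injectiveP fi /eqP<-]].
  by rewrite card_ime // prednK // card_gt0.
have WN : #|pairs Y|%:R <= n ^+ 2.
  rewrite -natrX ler_nat /pairs card_draws bin2 -divn2; apply: leq_trans (leq_div _ _) _.
  by rewrite -mulnn leq_mul // leq_pred.
have pN : pA * n ^+ 2 <= L%:R by rewrite mulrC.
have [f Hf] := containers red_ratio_gt0 kgain pA_gt0 pA_le1 (exprn_gt0 2 n0) pN D0 WN w0 wl
  wdeg_copy_weight.
exists f => Q noQ; have [|S [SQ Ss QS fS]] := Hf Q.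
  move=> E EQ; apply/eqP; rewrite pnatr_eq0 -leqn0 leqNgt; apply: contra noQ.
  move=> /card_gt0P[f' /andP[fi /eqP fE]]; apply/existsP; exists f'.
  by rewrite fi fE.
exists S; split=> //; last by rewrite s_def.
apply: many_copies => //; rewrite -(sum_copy_weight (fun E => E \subset S :|: f S)).
have Sdeg : \sum_(E : {set {set Y}} | ~~ [disjoint E & S]) copy_weight E <= s%:R * D.
  apply: (@le_trans _ _ (\sum_(e in S) wdeg copy_weight [set e])).
    rewrite /wdeg (exchange_big_dep xpredT) //= [leLHS]big_mkcond; apply: ler_sum => E _.
    case: ifPn => [|_]; last exact: sumr_ge0.
    rewrite -setI_eq0 => /set0Pn[e /setIP[eE eS]].
    rewrite (bigD1 e) /=; last by rewrite eS sub1set.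
    by rewrite lerDl; apply: sumr_ge0.
  apply: (@le_trans _ _ (\sum_(e in S) D)).
    apply: ler_sum => e _; have := @wdeg_copy_weight [set e].
    by rewrite cards1 mulr1; apply; rewrite -card_gt0 cards1.
  rewrite sumr_const -[leLHS]mulr_natl ler_wpM2r ?(ltW D0) // ler_nat s_def; exact: Ss.
apply: (@le_trans _ _ (red_ratio * D * n ^+ 2 + s%:R * D)).
  apply: le_trans (lerD (ltW fS) Sdeg).
  rewrite big_mkcond [X in _ <= X + _]big_mkcond [X in _ <= _ + X]big_mkcond -big_split /=.
  apply: ler_sum => E _; have := w0 E; move: (copy_weight E) => x x0.
  case: ifPn => [ESf|_]; last by apply: addr_ge0; case: ifP.
  case: (boolP (E \subset f S)) => [_|/negP EfS]; first by rewrite lerDl; case: ifP.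
  case: ifPn => [_|]; first by rewrite add0r.
  rewrite negbK disjoint_sym disjoints_subset => /subsetP SE; case: EfS; apply/subsetP => e eE.
  have /setUP[/SE|//] := subsetP ESf e eE; by rewrite inE eE.
rewrite -mulrA DN; apply: le_trans (_ : red_ratio * (degree_const * n ^+ #|A|) * 2 <= _).
  rewrite mulr_natr mulr2n lerD2l -DN [leRHS]mulrCA [leLHS]mulrC.
  by rewrite ler_wpM2l ?(ltW D0).
rewrite /red_ratio; have := degree_const_gt0; move: degree_const => c c0.
have rA0 : 0 < r ^+ #|A| by rewrite exprn_gt0.
move: (r ^+ #|A|) rA0 (n ^+ #|A|) => x x0 y; rewrite le_eqVlt; apply/orP; left; apply/eqP.
by field; rewrite !gt_eqF.
Qed.
End Fingerprints.

(** Here pA is the density of the containers for G, not that of the random graph. The first summand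
    is Markov's bound on clashes. In the exponent, s ln M + 2^(e_H) Q / M pays for the families K
    with their sets S1, b ln(n^2) + 1 for the sets S2, and the rest is Janson's inequality. *)
Theorem finite_bound (p tau pA b M : R) (L k s : nat) :
  0 <= p <= 1 -> 0 <= tau ->
  (forall J : {set {set B}}, J \subset EB -> J != set0 -> J != EB ->
    n ^+ (#|B| - #|cover J|) * p ^+ (#|EB| - #|J|) <= tau) ->
  0 < pA -> pA <= 1 ->
  (forall J : {set {set A}}, J \subset EA -> J != set0 ->
    1 <= n ^+ (#|cover J| - 2) * pA ^+ #|J|.-1) ->
  4 * r ^+ 2 <= n -> n ^+ 2 * pA <= L%:R -> 1 <= k%:R * cont_gain #|EA|.-1 red_ratio ->
  s = (k * (#|EA|.-1 * L))%N -> s%:R <= red_ratio * n ^+ 2 ->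
  0 < b -> 1 <= M ->
  let Q := n ^+ #|B| * p ^+ #|EB| in
  Ex (@edge_prob R Y p) (fun X => (~~ arrow EA EB X)%:R) <=
  clash_const * tau * Q / b +
  expR (s%:R * ln M + 2 ^+ #|EB| * Q / M + (b * ln (n ^+ 2) + 1) +
        (- (blue_ratio * Q) + clash_const * tau * Q)).
Proof.
move=> p01 tau0 Htau pA0 pA1 HA nr pAL kg s_def s_le b0 M1; cbv zeta; set Q := n ^+ #|B| * p ^+ #|EB|.
have [p0 p1] := andP p01.
have r0 := ramsey_bound_gt0.
have n0 : 0 < n by apply: lt_le_trans nr; rewrite mulr_gt0 ?exprn_gt0.
have n1 : 1 <= n by rewrite ler1n -(ltr0n R).
have [f Hf] := fingerprints pA0 pA1 HA nr pAL kg s_def s_le.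
pose good (S : {set {set Y}}) := blue_ratio * n ^+ #|B| <= #|[set C in copiesB | C \subset ~: (S :|: f S)]|%:R.
pose J := expR (- (blue_ratio * Q) + clash_const * tau * Q).
have HJ S : good S -> Ex (@edge_prob R Y p) (fun X => (none (avoiding EB (S :|: f S)) X)%:R) <= J.
  move=> gS; apply: le_trans (janson_copies p01 tau0 Htau _) _.
  rewrite ler_expR lerD2r lerN2 /Q mulrA ler_wpM2r ?exprn_ge0 //.
have Hf' S : ~~ has_copy EA S -> exists S0 : {set {set Y}},
    [/\ S0 \subset S, good S0, (#|S0| <= s)%N & S :&: pairs Y \subset S0 :|: f S0].
  exact: Hf.
apply: (le_trans (union_bound EB2 p01 b0 (expR_ge0 _) Hf' HJ)).
apply: lerD; first by rewrite ler_wpM2r ?invr_ge0 ?(ltW b0) // Ex_clash_count_le.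
rewrite [in leRHS]expRD ler_wpM2r ?expR_ge0 //.
rewrite [in leRHS]expRD; apply: ler_pM.
- by apply: sumr_ge0 => K _; rewrite !exprn_ge0 ?mulr_ge0 ?exprn_ge0.
- by apply: sumr_ge0 => K _; rewrite expr1n.
- apply: (le_trans (small_subsets _ _ _ M1)); first by rewrite mulr_ge0 ?exprn_ge0.
  rewrite ler_expR lerD2l /Q [in leRHS]mulrCA -[leRHS]mulrA.
  rewrite ler_wpM2r //.
    by rewrite divr_ge0 ?mulr_ge0 ?exprn_ge0 // (le_trans ler01).
  rewrite -natrX ler_nat -card_ffun.
  exact: leq_trans (leq_imset_card _ _) (max_card _).
(* Taking n^2 for the parameter M of [small_subsets] makes the at most n^2 pairs contribute only 1
   to the exponent. *)
apply: (le_trans (small_subsets _ _ ler01 (_ : 1 <= n ^+ 2))); first by rewrite exprn_ege1.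
rewrite ler_expR lerD2l mul1r ler_pdivrMr ?exprn_gt0 // mul1r.
rewrite -natrX ler_nat /pairs card_draws bin2 -divn2; apply: leq_trans (leq_div _ _) _.
by rewrite -mulnn leq_mul // leq_pred.
Qed.
End FiniteBound.

(** * Graphs and densities *)

Section Translation.
Variables (T : finType) (G : graph T).

(** The counting above concerns edge sets on a whole finite type, so the vertex set becomes a type
    of its own. *)
Definition vtx : finType := {x : T | x \in verts G}.
Definition edg : {set {set vtx}} := [set e : {set vtx} | val @: e \in edges G].

Lemma edges_axiom e : e \in edges G -> #|e| = 2%N /\ e \subset verts G.
Proof.
rewrite /edges /verts; case: G => g /= /forall_inP gP /gP /andP[/eqP-> ->].
by [].
Qed.

Lemma imset_val_inj : injective (fun e : {set vtx} => val @: e).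
Proof. exact/imset_inj/val_inj. Qed.

Lemma edg2 e : e \in edg -> #|e| = 2%N.
Proof. by rewrite inE => /edges_axiom[<- _]; rewrite card_imset //; apply: val_inj. Qed.

Lemma edges_val (e : {set T}) : e \in edges G -> exists2 e' : {set vtx}, e' \in edg & e = val @: e'.
Proof.
move=> eG; have [_ /subsetP eV] := edges_axiom eG.
have ee : e = val @: [set x : vtx | val x \in e].
  apply/setP => x; apply/idP/imsetP => [xe|[y]]; last by rewrite inE => ? ->.
  by exists (Sub x (eV x xe)); rewrite ?inE SubK.
by exists [set x : vtx | val x \in e] => //; rewrite inE -ee.
Qed.

Lemma edges_imset : edges G = (fun e : {set vtx} => val @: e) @: edg.
Proof.
apply/setP => e; apply/idP/imsetP => [/edges_val[e' ? ->]|[e' + ->]]; first by exists e'.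
by rewrite inE.
Qed.

Lemma card_edg : #|edg| = nedges G.
Proof. by rewrite /nedges edges_imset card_imset //; apply: imset_val_inj. Qed.

Lemma card_vtx : #|vtx| = nverts G.
Proof. by rewrite card_sig. Qed.

Lemma containsE (Y : finType) (F : graph Y) : verts F = setT ->
  contains F G = has_copy edg (edges F).
Proof.
move=> FT; apply/existsP/existsP => [] [f].
  case/and3P => fi _ /forallP fE; exists f; rewrite fi ime_sub; apply/forall_inP => e eE.
  have /eqP/cards2P[x [y [xy ee]]] := edg2 eE.
  move: eE; rewrite inE ee !imsetU1 !imset_set1 => eG.
  by have /forallP/(_ y) := fE x; rewrite eG.
case/andP => fi; rewrite ime_sub => /forall_inP fE; exists f; rewrite fi /=.
apply/andP; split; first by apply/forallP => x; rewrite FT inE.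
apply/forallP => x; apply/forallP => y; apply/implyP => xy.
have := fE [set x; y]; rewrite inE !imsetU1 !imset_set1; exact.
Qed.

Lemma spanned_axiom (J : {set {set vtx}}) : J \subset edg ->
  graph_axiom (val @: cover J, (fun e : {set vtx} => val @: e) @: J).
Proof.
move=> JE; apply/forall_inP => _ /= /imsetP[e eJ ->].
rewrite card_imset ?(edg2 (subsetP JE e eJ)) ?eqxx; last exact: val_inj.
by apply/imsetS/bigcup_sup.
Qed.

(** Without isolated vertices: its number of vertices is [#|cover J|], the quantity in all
    exponents. *)
Definition spanned (J : {set {set vtx}}) (JE : J \subset edg) : graph T :=
  Graph (spanned_axiom JE).

Lemma nverts_spanned (J : {set {set vtx}}) (JE : J \subset edg) : nverts (spanned JE) = #|cover J|.
Proof. by rewrite /nverts card_imset //; apply: val_inj. Qed.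

Lemma nedges_spanned (J : {set {set vtx}}) (JE : J \subset edg) : nedges (spanned JE) = #|J|.
Proof. by rewrite /nedges card_imset //; apply: imset_val_inj. Qed.

Lemma spanned_subgraph (J : {set {set vtx}}) (JE : J \subset edg) : subgraph (spanned JE) G.
Proof.
apply/andP; split; last by rewrite edges_imset; apply: imsetS.
by apply/subsetP => _ /imsetP[x _ ->]; apply: valP.
Qed.

End Translation.

(** * The binomial random graph as a random set of pairs *)

Section GnpProduct.
Variables (R : realType) (n : nat).
Local Notation Y := 'I_n.

Lemma graph_of_axiom (X : {set {set Y}}) : graph_axiom (setT, X :&: pairs Y).
Proof.
by apply/forall_inP => e /=; rewrite !inE subsetT andbT => /andP[].
Qed.

Definition graph_of X : graph Y := Graph (graph_of_axiom X).

Lemma edges_pairs (F : graph Y) : edges F \subset pairs Y.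
Proof. by apply/subsetP => e /edges_axiom[e2 _]; rewrite inE e2. Qed.

Lemma graph_of_edges (F : graph Y) : verts F = setT -> graph_of (edges F) = F.
Proof.
move=> FT; apply: val_inj; rewrite /= (setIidPl (edges_pairs F)) -FT.
by rewrite /verts /edges; case: (F) => -[].
Qed.

Lemma Gnp_probE (p : R) (P : pred (graph Y)) :
  Gnp_prob p P = Ex (edge_prob p) (fun X => (P (graph_of X))%:R).
Proof.
rewrite /Ex (bigID (fun X : {set {set Y}} => X \subset pairs Y)) /= [X in _ + X]big1 ?addr0.
  rewrite (reindex_onto (@edges Y) graph_of) /=; last first.
    by move=> X XP; rewrite /edges /= (setIidPl XP).
  rewrite /Gnp_prob big_mkcondr /=; apply: eq_big => [F|F /eqP FT].
    rewrite edges_pairs /=; apply/eqP/eqP => [/graph_of_edges //|<-] //.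
  rewrite graph_of_edges //; case: (P F); rewrite ?mulr1 ?mulr0 // /mu.
  rewrite [RHS](bigID (fun e => e \in pairs Y)) /= [X in _ * X]big1 ?mulr1.
    apply: eq_big => [e|e e2]; first by rewrite inE.
    by rewrite /edge_prob inE e2.
  move=> e eP; rewrite /edge_prob (negbTE eP) subr0.
  by case: ifP => // /(subsetP (edges_pairs F)); rewrite (negbTE eP).
move=> X /subsetPn[e eX eP]; rewrite /mu (bigD1 e) //= eX /edge_prob (negbTE eP).
by rewrite !mul0r.
Qed.

Lemma arrow_arrows (T U : finType) (G : graph T) (H : graph U) (X : {set {set Y}}) :
  X \subset pairs Y -> arrow (edg G) (edg H) X -> arrows (graph_of X) G H.
Proof.
move=> XP /forallP aX; apply/forallP => c; rewrite !containsE //.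
have := aX [set e | c e]; congr (_ || _); congr has_copy.
  by rewrite /edges /=; apply/setP => e; rewrite !inE; have := subsetP XP e; rewrite inE;
    case: (e \in X) => //= ->.
by rewrite /edges /=; apply/setP => e; rewrite !inE; have := subsetP XP e; rewrite inE;
    case: (e \in X) => //= [->|]; rewrite ?andbF ?andbT.
Qed.

Lemma Gnp_prob_ge (T U : finType) (G : graph T) (H : graph U) (p : R) : 0 <= p <= 1 ->
  1 - Ex (@edge_prob R Y p) (fun X => (~~ arrow (edg G) (edg H) X)%:R) <=
  Gnp_prob p (fun F : graph Y => arrows F G H).
Proof.
move=> p01; rewrite Gnp_probE lerBlDr -[leLHS](Ex_cst (@edge_prob R Y p)) -ExD.
apply: ler_sum => X _; have [XP|/subsetPn[e eX eP]] := boolP (X \subset pairs Y).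
  rewrite ler_wpM2l ?mu_ge0 //; first exact: edge_prob01.
  case: (boolP (arrow _ _ X)) => [/(arrow_arrows XP)->|_] /=.
    by rewrite addr0.
  by rewrite lerDr ler0n.
rewrite /mu (bigD1 e) //= eX /edge_prob (negbTE eP); by rewrite !mul0r.
Qed.

Lemma Gnp_prob_le1 (p : R) (P : pred (graph Y)) : 0 <= p <= 1 -> Gnp_prob p P <= 1.
Proof.
move=> p01; rewrite Gnp_probE -[leRHS](Ex_cst (@edge_prob R Y p)); apply: le_Ex.
  exact: edge_prob01.
by move=> X; rewrite -[leRHS]/(1%:R) ler_nat leq_b1.
Qed.

Lemma not_arrow_anti (A B : finType) (EA : {set {set A}}) (EB : {set {set B}}) (q p : R) :
  0 <= q <= 1 -> 0 <= p <= 1 -> q <= p ->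
  Ex (@edge_prob R Y p) (fun X => (~~ arrow EA EB X)%:R) <=
  Ex (@edge_prob R Y q) (fun X => (~~ arrow EA EB X)%:R).
Proof.
move=> q01 p01 qp.
have compl r : Ex (@edge_prob R Y r) (fun X => (~~ arrow EA EB X)%:R) =
    1 - Ex (@edge_prob R Y r) (fun X => (arrow EA EB X)%:R).
  apply/(canRL (addrK _)); rewrite -ExD -[RHS](Ex_cst (@edge_prob R Y r)).
  by apply: eq_Ex => X; case: arrow; rewrite ?addr0 ?add0r.
rewrite !compl lerD2l lerN2; apply: Ex_mono; try exact: edge_prob01.
- by move=> e; rewrite /edge_prob; case: ifP.
- by move=> X Z XZ; apply: ler_bool; apply: arrowS.
Qed.

End GnpProduct.

Section Densities.
Variables (T : finType) (G : graph T).

Lemma nonmatching_cherry : ~~ matching G ->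
  exists J : {set {set vtx G}}, [/\ J \subset edg G, #|J| = 2%N & #|cover J| = 3%N].
Proof.
rewrite /matching => nm.
have [x] : exists x, (1 < degree G x)%N.
  apply/existsP; rewrite -[[exists _, _]]negbK; apply: contra nm => /existsPn dx.
  by apply/bigmax_leqP => x _; rewrite leqNgt.
rewrite /degree => /card_gt1P[e1 [e2 []]]; rewrite !inE.
move=> /andP[/edges_val[f1 f1G ->] xf1] /andP[/edges_val[f2 f2G ->] xf2] f12.
have {}f12 : f1 != f2 by apply: contraNneq f12 => ->.
exists [set f1; f2]; split.
- by apply/subsetP => f; rewrite !inE => /orP[]/eqP->; [move: f1G|move: f2G]; rewrite inE.
- by rewrite cards2 f12.
have cov : cover [set f1; f2] = f1 :|: f2.
  by rewrite /cover bigcup_setU !big_set1.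
have := cardsU f1 f2; rewrite -cov (edg2 f1G) (edg2 f2G).
suff -> : #|f1 :&: f2| = 1%N by [].
have [[y yf1 xy] [z zf2 xz]] := (imsetP xf1, imsetP xf2).
have yz : y = z by apply: val_inj; rewrite -xy -xz.
apply/eqP; rewrite eqn_leq; apply/andP; split; last first.
  by apply/card_gt0P; exists y; rewrite inE yf1 yz zf2.
rewrite leqNgt; apply: contra f12 => c2.
have s1 : f1 :&: f2 = f1 by apply/eqP; rewrite eqEcard subsetIl (edg2 f1G).
have s2 : f1 :&: f2 = f2 by apply/eqP; rewrite eqEcard subsetIr (edg2 f2G).
by rewrite -s1 -[in eqbRHS]s2.
Qed.

Lemma d2_le_m2 (J : graph T) : subgraph J G -> d2 J <= m2 G.
Proof. by move=> JG; apply: le_bigmax_cond. Qed.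

(** The path with two edges has d_2 = 1. This bound ensures n^(2 - 1/m_2(G)) >= n. *)
Lemma m2_ge1 : ~~ matching G -> 1 <= m2 G.
Proof.
move=> /nonmatching_cherry[J [JE J2 J3]].
apply: le_trans (d2_le_m2 (spanned_subgraph JE)).
by rewrite /d2 nedges_spanned nverts_spanned J2 J3.
Qed.

Lemma card_cover_edg (J : {set {set vtx G}}) : J \subset edg G -> J != set0 ->
  (2 <= #|cover J|)%N.
Proof.
move=> JE /set0Pn[e eJ]; rewrite -(edg2 (subsetP JE e eJ)); apply: subset_leq_card.
exact: bigcup_sup.
Qed.

Lemma m2_edges (J : {set {set vtx G}}) : J \subset edg G -> J != set0 ->
  #|J|%:R - 1 <= m2 G * (#|cover J|%:R - 2).
Proof.
move=> JE J0; have c2 := card_cover_edg JE J0.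
(* On two vertices J is a single edge and both sides vanish, whatever the convention for
   d_2(K_2). *)
have [c3|c3] := leqP 3 #|cover J|; last first.
  have c2' : #|cover J| = 2%N by apply/eqP; rewrite eqn_leq c2 -ltnS c3.
  rewrite c2' subrr mulr0 subr_le0 (_ : 1 = 1%:R) // ler_nat.
  rewrite -(cards1 (cover J)); apply: subset_leq_card; apply/subsetP => e eJ.
  by rewrite inE eqEcard bigcup_sup // (edg2 (subsetP JE e eJ)) c2'.
rewrite -ler_pdivrMr ?subr_gt0 ?(ltr_nat _ 2) //.
have := d2_le_m2 (spanned_subgraph JE).
by rewrite /d2 nedges_spanned nverts_spanned c3 cards_eq0 (negbTE J0).
Qed.

End Densities.

Section AsymmetricDensities.
Variables (T U : finType) (G : graph T) (H : graph U).
Hypothesis G_not_matching : ~~ matching G.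
Hypothesis H_not_matching : ~~ matching H.
Hypothesis H_strictly_balanced : strictly_balanced G H.

Lemma nonmatching_edg (V : finType) (F : graph V) : ~~ matching F -> edg F != set0.
Proof.
move=> /nonmatching_cherry[J [JE J2 _]]; rewrite -card_gt0.
by apply: leq_trans (subset_leq_card JE); rewrite J2.
Qed.

Let g_gt0 : 0 < m2 G.
Proof. exact: lt_le_trans ltr01 (m2_ge1 G_not_matching). Qed.

Let G_edges : (1 <= nedges G)%N.
Proof. by rewrite -card_edg card_gt0 nonmatching_edg. Qed.

Lemma m2_asymE : m2_asym G H = #|edg H|%:R / (#|vtx H|%:R - 2 + 1 / m2 G).
Proof.
have [-> _] := H_strictly_balanced.
by rewrite /d2_asym G_edges -card_edg card_gt0 nonmatching_edg // -card_vtx.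
Qed.

Lemma denom_gt0 (c : nat) : (2 <= c)%N -> 0 < c%:R - 2 + 1 / m2 G.
Proof. by move=> c2; rewrite ltr_wpDl ?divr_gt0 // subr_ge0 (ler_nat _ 2). Qed.

Lemma d2_asym_spanned (J : {set {set vtx H}}) (JE : J \subset edg H) : J != set0 ->
  d2_asym G (spanned JE) = #|J|%:R / (#|cover J|%:R - 2 + 1 / m2 G).
Proof. by move=> J0; rewrite /d2_asym G_edges nedges_spanned nverts_spanned card_gt0 J0. Qed.

Lemma vtx_ge2 : (2 <= #|vtx H|)%N.
Proof.
apply: leq_trans (max_card _); apply: card_cover_edg (subxx (edg H)) _.
exact: nonmatching_edg.
Qed.

Lemma m2_asym_gt0 : 0 < m2_asym G H.
Proof.
rewrite m2_asymE divr_gt0 ?denom_gt0 ?vtx_ge2 // ltr0n card_gt0.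
exact: nonmatching_edg.
Qed.

(** Dropping isolated vertices keeps the edges and shrinks the denominator of the density, which
    strict balancedness forbids for a proper subgraph. *)
Lemma cover_edgH : cover (edg H) = setT.
Proof.
have E0 := nonmatching_edg H_not_matching.
apply/eqP; rewrite eqEcard subsetT cardsT leqNgt; apply/negP => lt.
have [_ /(_ (spanned (subxx (edg H))))] := H_strictly_balanced.
rewrite /proper_subgraph spanned_subgraph d2_asym_spanned //= => /(_ _).
rewrite m2_asymE ltNge => /(_ _)/negP; apply; last first.
  apply: ler_wpM2l; first exact: ler0n.
  rewrite lef_pV2 ?posrE ?denom_gt0 ?vtx_ge2 ?card_cover_edg //.
  by rewrite lerD2r lerD2r ler_nat ltnW.
apply: contraTneq lt => spE; rewrite card_vtx -[in X in (_ < X)%N]spE nverts_spanned.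
by rewrite ltnn.
Qed.

Lemma m2_asym_edges (J : {set {set vtx H}}) : J \subset edg H -> J != set0 -> J != edg H ->
  #|J|%:R < m2_asym G H * (#|cover J|%:R - 2 + 1 / m2 G).
Proof.
move=> JE J0 JH; rewrite -ltr_pdivrMr ?denom_gt0 ?card_cover_edg //.
rewrite -d2_asym_spanned //; apply: (proj2 H_strictly_balanced).
rewrite /proper_subgraph spanned_subgraph; apply: contraNneq JH => spE.
by rewrite eqEcard JE card_edg -[in leqLHS]spE nedges_spanned /=.
Qed.

End AsymmetricDensities.

(** * Asymptotics *)

Section Powers.
Variable R : realType.
Implicit Types (x y a : R).

Lemma powR_addn x a (k : nat) : 0 < x -> x ^+ k * x `^ a = x `^ (k%:R + a).
Proof.
move=> x0; rewrite powRD; last by rewrite (lt0r_neq0 x0) implybT.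
by rewrite powR_mulrn // ltW.
Qed.

Lemma powR_expr x a (k : nat) : (x `^ a) ^+ k = x `^ (a * k%:R).
Proof. by rewrite powRrM powR_mulrn // powR_ge0. Qed.

Lemma powR_ge1 x a : 1 <= x -> 0 <= a -> 1 <= x `^ a.
Proof. by move=> x1 a0; rewrite -(powRr0 x) ler_powR. Qed.

Lemma powR_le1 x a : 1 <= x -> a <= 0 -> x `^ a <= 1.
Proof. by move=> x1 a0; rewrite -(powRr0 x) ler_powR. Qed.

Lemma eventually_powR_le (K a eta : R) : 0 < a -> 0 < eta ->
  exists N : nat, forall n : nat, (N <= n)%N -> K * n%:R `^ (- a) <= eta.
Proof.
move=> a0 eta0; pose x := `|K| / eta + 1.
have x0 : 0 < x by rewrite ltr_wpDl // divr_ge0 // ltW.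
exists (Num.truncn (x `^ a^-1)).+1 => n Nn.
have xn : x `^ a^-1 <= n%:R.
  have /andP[_ /ltW/le_trans] := truncn_itv (powR_ge0 x a^-1).
  by apply; rewrite ler_nat.
have xa : x <= n%:R `^ a.
  have -> : x = (x `^ a^-1) `^ a by rewrite -powRrM mulVf ?lt0r_neq0 // powRr1 // ltW.
  by apply: (ge0_ler_powR (ltW a0)); rewrite ?nnegrE ?powR_ge0 ?ler0n.
have na0 : 0 < n%:R `^ a by apply: lt_le_trans xa.
rewrite powRN ler_pdivrMr //; apply: le_trans (ler_norm K) _.
rewrite -ler_pdivrMl // mulrC; apply: le_trans xa; by rewrite lerDl.
Qed.

Lemma ln_le_powR x a : 1 <= x -> 0 < a -> ln x <= a^-1 * x `^ a.
Proof.
move=> x1 a0; rewrite -ler_pdivrMl ?invr_gt0 // invrK -ln_powR.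
have p0 : 0 < x `^ a by rewrite powR_gt0 // (lt_le_trans ltr01).
by apply: le_trans (ltW (ln_sublinear p0)) _.
Qed.

Lemma expR_oneB_le y : 0 < y -> expR (1 - y) <= y^-1.
Proof.
move=> y0; rewrite -opprB expRN lef_pV2 ?posrE ?expR_gt0 //.
by have := expR_ge1Dx (y - 1); lra.
Qed.

End Powers.

Section Arithmetic.
Variable R : realFieldType.
Implicit Types (c d u v x y z l E K S : R).

Lemma leq_addn7 (a b c d e f g n : nat) : (a + (b + c + d + e + f + g) <= n)%N ->
  [/\ (a <= n)%N, (b <= n)%N, (c <= n)%N, (d <= n)%N &
      [/\ (e <= n)%N, (f <= n)%N & (g <= n)%N]].
Proof. by move=> le; split; [..|split]; lia. Qed.

Lemma exponent_le c S E x (t1 t2 t3 t4 : R) : 0 < c -> 1 <= E -> 0 <= S -> x <= S ->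
  t1 <= c / 4 * (E * S) -> t2 <= c / 4 * (E * S) -> t3 <= c / 8 * S ->
  t4 <= c / 8 * (E * S) ->
  t1 + t2 + (t3 + 1) + (- (c * (E * S)) + t4) <= 1 - c / 4 * x.
Proof.
move=> c0 E1 S0 xS.
have SE : c * S <= c * (E * S) by rewrite ler_wpM2l ?ler_peMl // ltW.
have xS' : c * x <= c * S by rewrite ler_wpM2l // ltW.
rewrite ![c / _ * _]mulrAC; move: SE xS'.
move: (c * S) (c * (E * S)) (c * x) => u v w; lra.
Qed.

Lemma subr2_ge1 u : u <= 1 -> 1 <= 2 + - u.
Proof. lra. Qed.

Lemma addr1_le_double u S : u <= S -> 1 <= S -> u + 1 <= 2 * S.
Proof. lra. Qed.

Lemma log_term_le c K S l : 0 < c -> 0 <= S ->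
  K * (2 * S) * l <= c / 4 * ((1 + 8 * K * l / c) * S).
Proof.
move=> c0 S0; have : 0 <= c / 4 * S by rewrite mulr_ge0 // divr_ge0 // ltW.
rewrite (_ : c / 4 * ((1 + 8 * K * l / c) * S) = c / 4 * S + K * (2 * S) * l).
  by rewrite lerDr.
by field; rewrite gt_eqF.
Qed.

Lemma cancel_quarter c e : c != 0 -> c / 4 * (4 * e / c) = e.
Proof. by move=> c0; field. Qed.

Lemma double_le y l d z : y * l <= y * (4 / d * z) -> y * (2 * l) <= 8 / d * (y * z).
Proof.
rewrite (_ : y * (4 / d * z) = 4 / d * (y * z)); last by ring.
rewrite (_ : y * (2 * l) = 2 * (y * l)); last by ring.
rewrite (_ : 8 / d * (y * z) = 2 * (4 / d * (y * z))); last by ring.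
by move: (y * l) (4 / d * (y * z)) => u v; lra.
Qed.

Lemma half_to_quarter d : - (d / 2) + d / 4 = - (d / 4).
Proof. by field. Qed.

Lemma regroup_density K x y : K * (2 * (x * y)) = 2 * K * y * x.
Proof. by ring. Qed.

Lemma regroup_clash c E y S : c * (E * (y * y)) * (E * S) = c * E ^+ 2 * y * (y * S).
Proof. by ring. Qed.

End Arithmetic.

Section Asymptotics.
Variables (R : realType) (T U : finType) (G : graph T) (H : graph U).
Hypothesis G_not_matching : ~~ matching G.
Hypothesis H_not_matching : ~~ matching H.
Hypothesis H_strictly_balanced : strictly_balanced G H.

Local Notation A := (vtx G).
Local Notation B := (vtx H).
Local Notation EA := (edg G).
Local Notation EB := (edg H).
Local Notation gam := (ratr (m2 G) : R).
Local Notation m := (ratr (m2_asym G H) : R).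

Lemma m2R_ge1 : 1 <= gam.
Proof. by rewrite -(rmorph1 (ratr : rat -> R)) ler_rat m2_ge1. Qed.

Lemma m2_asymR_gt0 : 0 < m.
Proof. by rewrite ltr0q m2_asym_gt0. Qed.

Lemma m2R_edges (J : {set {set A}}) : J \subset EA -> J != set0 ->
  #|J|.-1%:R <= gam * (#|cover J| - 2)%N%:R.
Proof.
move=> JE J0; have := m2_edges JE J0; rewrite -(ler_rat R).
rewrite rmorphM !rmorphB /= !ratr_nat.
by rewrite natrB ?card_cover_edg // -subn1 natrB ?card_gt0 // rmorph1.
Qed.

Lemma m2_asymR_edges : #|EB|%:R / m = #|B|%:R - 2 + 1 / gam.
Proof.
have d0 := denom_gt0 G_not_matching (vtx_ge2 H_not_matching).
have e0 : (#|EB|%:R : rat) != 0.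
  by rewrite pnatr_eq0 -lt0n card_gt0 (nonmatching_edg H_not_matching).
have : #|EB|%:R / m2_asym G H = #|B|%:R - 2 + 1 / m2 G.
  rewrite (m2_asymE G_not_matching H_not_matching H_strictly_balanced).
  by rewrite invf_div mulrCA divff // mulr1.
move/(congr1 (ratr : rat -> R)).
rewrite fmorph_div /= ratr_nat rmorphD /= rmorphB /= fmorph_div /= !ratr_nat => ->; by rewrite rmorph1.
Qed.

(** Up to a constant, n^(v_H - v_J) p^(e_H - e_J) is n^(-gap J): the expected number of ways to
    extend a copy of J to a copy of H. *)
Definition gap (J : {set {set B}}) : R :=
  (#|EB| - #|J|)%N%:R / m - (#|B| - #|cover J|)%N%:R.

Lemma gap_gt0 (J : {set {set B}}) : J \subset EB -> J != set0 -> J != EB -> 0 < gap J.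
Proof.
move=> JE J0 JH.
have := m2_asym_edges G_not_matching H_strictly_balanced JE J0 JH.
rewrite -(ltr_rat R) rmorphM /= rmorphD /= rmorphB /= fmorph_div /= !ratr_nat rmorph1.
rewrite -ltr_pdivrMl ?m2_asymR_gt0 // mulrC => lt.
rewrite /gap natrB ?subset_leq_card // natrB ?max_card // mulrBl m2_asymR_edges.
by move: lt; lra.
Qed.

Lemma uniform_gap : exists2 del : R, 0 < del & forall J : {set {set B}},
  J \subset EB -> J != set0 -> J != EB -> del <= gap J.
Proof.
pose P (J : {set {set B}}) := [&& J \subset EB, J != set0 & J != EB].
(* Finitely many positive gaps have a positive minimum; the default 1 only has to be positive
   too. *)
exists (\big[Order.min/1]_(J | P J) gap J).
  by apply/bigmin_gtP; split=> // J /and3P[? ? ?]; apply: gap_gt0.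
move=> J JE J0 JH; apply: bigmin_le_cond; by rewrite /P JE J0 JH.
Qed.

Section FixedSize.
Variables (x C del : R).
Hypotheses (x1 : 1 <= x) (C1 : 1 <= C).
Let x0 : 0 < x. Proof. exact: lt_le_trans x1. Qed.
Let p := C * x `^ (- (1 / m)).
Let pA := x `^ (- (1 / gam)).

(** The exponent of x is v_J - 2 - (e_J - 1) / m_2(G), nonnegative by the maximality in m_2(G). *)
Lemma red_density (J : {set {set A}}) : J \subset EA -> J != set0 ->
  1 <= x ^+ (#|cover J| - 2) * pA ^+ #|J|.-1.
Proof.
move=> JE J0; rewrite powR_expr powR_addn // powR_ge1 // mulNr mul1r.
rewrite subr_ge0 mulrC ler_pdivrMr ?(lt_le_trans ltr01 m2R_ge1) // mulrC.
exact: m2R_edges.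
Qed.

Lemma blue_density (J : {set {set B}}) : del <= gap J ->
  x ^+ (#|B| - #|cover J|) * p ^+ (#|EB| - #|J|) <= C ^+ #|EB| * x `^ (- del).
Proof.
move=> dJ; rewrite exprMn mulrCA powR_expr powR_addn //.
apply: ler_pM; rewrite ?powR_ge0 ?exprn_ge0 ?(le_trans ler01) //.
  by rewrite ler_weXn2l ?leq_subr.
by apply: ler_powR => //; move: dJ; rewrite /gap; lra.
Qed.

(** The shape of the denominator in d_2(G,H) gives e_H / m_2(G,H) = v_H - 2 + 1/m_2(G), so the count
    of copies of H has the order of the fingerprint size. *)
Lemma blue_count : x ^+ #|B| * p ^+ #|EB| = C ^+ #|EB| * (x ^+ 2 * pA).
Proof.
rewrite exprMn mulrCA; congr (_ * _); rewrite powR_expr !powR_addn //; congr (_ `^ _).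
by rewrite mulNr mul1r mulrC m2_asymR_edges; lra.
Qed.

End FixedSize.


Theorem not_arrow_vanishes : exists2 C : R, 0 < C & forall eta : R, 0 < eta ->
  exists N : nat, forall n : nat, (N <= n)%N ->
  let p := C * n%:R `^ (- (1 / m)) in
  p <= 1 /\ Ex (@edge_prob R 'I_n p) (fun X => (~~ arrow EA EB X)%:R) <= eta.
Proof.
have [del del0 Hdel] := uniform_gap.
set ratio := red_ratio R B EA; set c := blue_ratio R A B; set cB := clash_const R EB.
have ratio_gt0 : 0 < ratio by apply: red_ratio_gt0.
have c0 : 0 < c by apply: blue_ratio_gt0.
have cB0 : 0 <= cB by apply: ler0n.
have gain0 := cont_gain_gt0 #|EA|.-1 ratio_gt0.
have [k kgain] : exists k : nat, 1 <= k%:R * cont_gain #|EA|.-1 ratio.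
  exists (Num.truncn (cont_gain #|EA|.-1 ratio)^-1).+1; rewrite -ler_pdivrMr // mul1r.
  by have /andP[_ /ltW] := truncn_itv (ltW (etrans (invr_gt0 _) gain0)).
pose K : R := (k * #|EA|.-1)%N%:R; have K0 : 0 <= K by apply: ler0n.
pose e2 : R := 2 ^+ #|EB|; have e20 : 0 <= e2 by apply: exprn_ge0.
(* M makes the sum over disjoint families cost c / 4 of the exponent c Q in
   Janson's inequality; then C makes Q exceed the remaining s * ln M. *)
pose M : R := 1 + 4 * e2 / c.
have M1 : 1 <= M.
  by rewrite lerDl (divr_ge0 _ (ltW c0)) // mulr_ge0.
have lnM0 : 0 <= ln M by apply: ln_ge0.
pose C : R := 1 + 8 * K * ln M / c.
have C1 : 1 <= C.
  by rewrite lerDl (divr_ge0 _ (ltW c0)) // (mulr_ge0 _ lnM0) // (mulr_ge0 _ K0).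
have C0 : 0 < C by apply: lt_le_trans C1.
pose E : R := C ^+ #|EB|.
have eB_gt0 : (0 < #|EB|)%N by rewrite card_gt0 nonmatching_edg.
have CE : C <= E by rewrite -[leLHS]expr1 ler_weXn2l.
have E1 : 1 <= E by apply: le_trans CE.
have E0 : 0 < E by apply: lt_le_trans E1.
exists C => // eta eta0.
have eta2 : 0 < eta / 2 by rewrite divr_gt0.
have gam0 : 0 < gam := lt_le_trans ltr01 m2R_ge1.
(* These thresholds serve, in turn: p <= 1; s <= ratio n^2; the Markov term; the cost b ln(n^2) of
   the sets S2; the clash term in Janson's exponent; the final bound by 1/n. *)
have [|N2 H2] := @eventually_powR_le R C (1 / m) 1 _ ltr01; first by rewrite divr_gt0 // m2_asymR_gt0.
have [|N3 H3] := @eventually_powR_le R (2 * K) (1 / gam) ratio _ ratio_gt0; first by rewrite divr_gt0.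
have [|N4 H4] := @eventually_powR_le R (cB * E ^+ 2) (del / 2) (eta / 2) _ eta2.
  by rewrite divr_gt0.
have del4 : 0 < del / 4 by rewrite divr_gt0.
have c8 : 0 < c / 8 by rewrite divr_gt0.
have [N5 H5] := eventually_powR_le (8 / del) del4 c8.
have [N6 H6] := eventually_powR_le (cB * E) del0 c8.
have [|N7 H7] := @eventually_powR_le R (4 / c) 1 (eta / 2) _ eta2; first exact: ltr01.
exists (4 * ramsey_bound A B ^ 2 + (N2 + N3 + N4 + N5 + N6 + N7))%N => n; cbv zeta.
move=> /leq_addn7[Nr /H2{}H2 /H3{}H3 /H4{}H4 [/H5{}H5 /H6{}H6 /H7{}H7]].
split; first exact: H2.
have nr : 4 * (ramsey_bound A B)%:R ^+ 2 <= n%:R :> R.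
  by rewrite -natrX -natrM ler_nat.
have x1 : 1 <= n%:R :> R.
  apply: le_trans nr; have := ramsey_bound_gt0 R A B; rewrite ltr0n => r0.
  by rewrite -natrX -natrM ler1n muln_gt0 expn_gt0 r0.
have x0 : 0 < n%:R :> R by apply: lt_le_trans x1.
pose pA : R := n%:R `^ (- (1 / gam)).
pose S : R := n%:R ^+ 2 * pA.
have xS : n%:R <= S.
  rewrite /S /pA powR_addn // -[leLHS]powRr1 ?ler0n // ler_powR //.
  by rewrite subr2_ge1 // ler_pdivrMr // mul1r m2R_ge1.
have S0 : 0 < S by apply: lt_le_trans xS.
pose L : nat := (Num.truncn S).+1.
have /andP[SL /ltW LS] := truncn_itv (ltW S0).
have L2 : L%:R <= 2 * S.
  by rewrite /L -natr1 addr1_le_double // (le_trans x1).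
pose s := (k * (#|EA|.-1 * L))%N.
have sK : s%:R <= K * (2 * S) by rewrite /s mulnA natrM ler_wpM2l.
(* Half of the gap goes to each side: the Markov term tau Q / b decays like n^(-del/2), and b ln n
   is still o(S). *)
pose b := n%:R `^ (- (del / 2)) * S.
have b0 : 0 < b by rewrite mulr_gt0 ?powR_gt0.
pose tau := E * n%:R `^ (- del).
have tau0 : 0 <= tau by rewrite mulr_ge0 ?powR_ge0 // ltW.
pose p := C * n%:R `^ (- (1 / m)).
have p01 : 0 <= p <= 1 by rewrite mulr_ge0 ?powR_ge0 //= ltW.
have cardn : #|'I_n| = n := card_ord n.
have Qdef : n%:R ^+ #|B| * p ^+ #|EB| = E * S by apply: blue_count.
have B0 : (0 < #|B|)%N := leq_trans (isT : (0 < 2)%N) (vtx_ge2 H_not_matching).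
have := @finite_bound R A B 'I_n EA EB (@edg2 _ G) (@edg2 _ H) (nonmatching_edg G_not_matching)
  (cover_edgH G_not_matching H_not_matching H_strictly_balanced) B0 p tau pA b M L k s p01 tau0.
rewrite cardn; cbv zeta; rewrite Qdef => fb.
apply: (le_trans (fb _ _ _ _ _ _ _ _ _ _ _)); rewrite ?powR_gt0 //.
- by move=> J JE J0 JH; apply: blue_density => //; apply: Hdel.
- by rewrite powR_le1 // oppr_le0 divr_ge0 // ltW.
- by move=> J JE J0; apply: red_density.
- apply: (le_trans sK); rewrite -/ratio /S.
  rewrite regroup_density.
  by rewrite ler_wpM2r // exprn_ge0 // ltW.
rewrite (splitr eta).
have half : n%:R `^ (- del) = n%:R `^ (- (del / 2)) * n%:R `^ (- (del / 2)).
  by rewrite -powRD ?(lt0r_neq0 x0) ?implybT // -opprD -splitr.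
apply: lerD.
  rewrite ler_pdivrMr // -/cB /tau /b half.
  move: H4; move: (n%:R `^ (- (del / 2))) (powR_ge0 (n%:R : R) (- (del / 2))) => y y0 H4.
  rewrite regroup_clash.
  by rewrite ler_wpM2r // mulr_ge0 // ltW.
rewrite -/c -/cB; apply: le_trans (_ : expR (1 - c / 4 * n%:R) <= _); last first.
  apply: le_trans (expR_oneB_le _) _; first by rewrite mulr_gt0 // divr_gt0.
  by apply: le_trans H7; rewrite powR_inv1 ?ler0n // invfM invf_div.
rewrite ler_expR; apply: exponent_le => //; first exact: ltW.
- apply: le_trans (ler_wpM2r lnM0 sK) _.
  apply: le_trans (_ : c / 4 * (C * S) <= _); last first.
    apply: ler_wpM2l; first by apply: divr_ge0 => //; apply: ltW.
    by apply: ler_wpM2r => //; apply: ltW.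
  by apply: log_term_le => //; apply: ltW.
- rewrite ler_pdivrMr ?(lt_le_trans ltr01 M1) // -/e2 mulrAC /M.
  rewrite mulrDr mulr1 cancel_quarter ?lt0r_neq0 //.
  apply: ler_wpM2r; first by apply: mulr_ge0; apply: ltW.
  by rewrite lerDr; apply: divr_ge0 => //; apply: ltW.
- rewrite /b mulrAC ler_wpM2r ?(ltW S0) //.
  have -> : ln (n%:R ^+ 2 : R) = 2 * ln (n%:R : R) by rewrite lnXn // mulr_natl.
  apply: le_trans H5.
  have quarter : n%:R `^ (- (del / 2)) * n%:R `^ (del / 4) = n%:R `^ (- (del / 4)) :> R.
    by rewrite -powRD ?(lt0r_neq0 x0) ?implybT // half_to_quarter.
  rewrite -quarter; have := ln_le_powR x1 del4; rewrite invf_div.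
  have y0 := powR_ge0 (n%:R : R) (- (del / 2)).
  by move=> /(ler_wpM2l y0)/double_le.
- by rewrite /tau [cB * _]mulrA; apply: ler_wpM2r => //; apply: mulr_ge0; apply: ltW.
Qed.

End Asymptotics.

(* Passage to the limit *)
From mathcomp Require Import all_classical all_reals all_analysis.
Import Order.TTheory GRing.Theory Num.Theory.
Import numFieldNormedType.Exports.
Local Open Scope classical_set_scope.
Local Open Scope ring_scope.

(* MathComp world.  The lower bound on p is required for all large n only: at *)
(* n = 1 it would read C <= p 1 <= 1 and make the claim vacuous for C > 1.    *)
Theorem theorem4 (R : realType) (T U : finType) (G : graph T) (H : graph U)
    (G_not_matching : ~~ matching G) (H_not_matching : ~~ matching H)
    (H_strictly_balanced : strictly_balanced G H) :
  exists C : R, 0 < C /\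
    forall p : nat -> R,
      (forall n, 0 <= p n <= 1) ->
      (\forall n \near \oo,
         C * n%:R `^ (- (1 / ratr (m2_asym G H))) <= p n) ->
      (fun n : nat =>
         Gnp_prob (p n) (fun F : graph 'I_n => arrows F G H)) @ \oo --> (1 : R).
Proof.
have [C C0 HC] := not_arrow_vanishes R G_not_matching H_not_matching H_strictly_balanced.
exists C; split=> // p p01 pC; apply/cvgrPdist_le => eta eta0.
have [N HN] := HC eta eta0; near=> n.
have nN : (N <= n)%N by near: n; exact: nbhs_infty_ge.
have pn : C * n%:R `^ (- (1 / ratr (m2_asym G H))) <= p n by near: n.
(* The estimate holds at q, the threshold itself. Failing to arrow is a decreasing property, so it
   carries over to every larger [p n]. *)
have [q1 qeta] := HN n nN; set q := C * _ in pn q1 qeta.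
have q0 : 0 <= q by rewrite mulr_ge0 ?powR_ge0 // ltW.
rewrite ger0_norm ?subr_ge0 ?Gnp_prob_le1 // lerBlDr -lerBlDl.
apply: (le_trans _ (Gnp_prob_ge n G H (p01 n))); apply: lerB => //; apply: (le_trans _ qeta).
by apply: not_arrow_anti => //; rewrite q0.
Unshelve. all: end_near.
Qed.
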